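(* Let $$\tau^{(E,F)}\big(N,n,\mathbf p^{(1)},\dots,\mathbf p^{(F)}\,|\,\{q_i,t_i,n_i\},\beta\big)=\sum_{\lambda,\ \ell(\lambda)\le N}r_\lambda(n)\,\big(\chi_\lambda(1)\big)^{E-F}\prod_{j=1}^{F}s_\lambda(\mathbf p^{(j)}),\qquad E\in\mathbb Z,$$ where $$r_\lambda(n)=e^{\beta f(\lambda,n)}\prod_{i=1}^k\left(\frac{s_\lambda(\mathbf p(q_it_i^n,t_i))}{s_\lambda(\mathbf p(0,t_i))}\right)^{n_i}.$$ This series generates the weighted sums $L^{E}_{d,N}$: $$\tau^{(E,F)}\big(N,n,\mathbf p^{(1)},\dots,\mathbf p^{(F)}\,|\,\{q_i,t_i,n_i\},\beta\big)=\sum_{d,b=0}^\infty\frac{\beta^b}{b!}\sum_{\Delta^{(1)},\dots,\Delta^{(F)}}L^{E}_{d,N}\big(\{n_i,q_it_i^n,t_i\}\,|\,b\,|\,\Delta^{(1)},\dots,\Delta^{(F)}\big)\prod_{i=1}^{F}\mathbf p^{(i)}_{\Delta^{(i)}},$$ where $\Delta^{(1)},\dots,\Delta^{(F)}$ run over the partitions of $d$.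
   Context: $F\ge0$ is an integer, and $n_i,q_i,t_i$ ($i=1,\dots,k$) are complex parameters. For a partition $\lambda$, $|\lambda|$ is its weight and $\ell(\lambda)$ its number of nonzero parts; $\mathbf p_\Delta=p_{d_1}p_{d_2}\cdots$ for $\Delta=(d_1,d_2,\dots)$. $\chi_\lambda$ is the irreducible character of $S_d$ ($d=|\lambda|$) labelled by $\lambda$, $\chi_\lambda(\Delta)$ its value on the class $C_\Delta$ of permutations of cycle type $\Delta$, $\chi_\lambda(1)=\dim\lambda$, and $|C_\Delta|$ is the size of the class. Schur functions in power-sum variables: $s_\lambda(\mathbf p)=\frac{1}{d!}\sum_{|\Delta|=d}|C_\Delta|\chi_\lambda(\Delta)\mathbf p_\Delta$. The $\mathbf p^{(j)}=(p^{(j)}_1,p^{(j)}_2,\dots)$ are sets of power-sum variables. $\mathbf p(Q,t)=(p_1(Q,t),p_2(Q,t),\dots)$ with $p_m(Q,t)=\frac{1-Q^m}{1-t^m}$, so $p_m(0,t)=\frac1{1-t^m}$. $f(\lambda,n)=n|\lambda|+|C_\Gamma|\frac{\chi_\lambda(\Gamma)}{\chi_\lambda(1)}$ with $\Gamma=(1^{d-2}2)$, $d=|\lambda|$. Hurwitz-type numbers: for partitions $\Delta^1,\dots,\Delta^m$ of $d$, $$H^{E,m}_{d,N}(\Delta^1,\dots,\Delta^m)=d!\sum_{|\lambda|=d,\ \ell(\lambda)\le N}\Big(\prod_{j=1}^m|C_{\Delta^j}|\frac{\chi_\lambda(\Delta^j)}{\chi_\lambda(1)}\Big)\Big(\frac{\chi_\lambda(1)}{d!}\Big)^{E}.$$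 For $N\ge d$ the source identifies these, through the Frobenius formula in this form, with the Hurwitz numbers of $d$-fold branched coverings of a connected surface of Euler characteristic $E$. Weights: for $\Delta=(d_1,\dots,d_\ell)$ a partition of $d$, $w_\Delta(Q,t)=\big(\frac{1-t}{1-Q}\big)^d\prod_{s=1}^{\ell}\frac{1-Q^{d_s}}{1-t^{d_s}}$. For a family $\mathbf c=(c_\Delta)$ of nonnegative integers indexed by the partitions $\Delta\ne(1^d)$ of $d$, let $|\mathbf c|=\sum_\Delta c_\Delta$ and $$W(\nu,Q,t,\mathbf c)=(-1)^{|\mathbf c|}(-\nu)_{|\mathbf c|}\prod_{\Delta\ne(1^d)}\frac{w_\Delta(Q,t)^{c_\Delta}}{c_\Delta!},\qquad (x)_m=x(x+1)\cdots(x+m-1).$$ Then $$L^{E}_{d,N}\big(\{n_i,Q_i,t_i\}|b|\Delta^{(1)},\dots,\Delta^{(F)}\big)=\sum_{\mathbf c^1,\bar{\mathbf c}^1,\dots,\mathbf c^k,\bar{\mathbf c}^k}H^{E,m}_{d,N}(\cdots)\prod_{i=1}^kW(n_i,Q_i,t_i,\mathbf c^i)\,W(-n_i,0,t_i,\bar{\mathbf c}^i),$$ where the $m=F+b+\sum_i(|\mathbf c^i|+|\bar{\mathbf c}^i|)$ arguments of $H$ are: each $\Delta'\neq(1^d)$ repeated $\sum_i(c^i_{\Delta'}+\bar c^i_{\Delta'})$ times, $\Gamma=(1^{d-2}2)$ repeated $b$ times, and $\Delta^{(1)},\dots,\Delta^{(F)}$.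
   Formalization: The degree-d part of the right side is multiplied by d!^{E-F-1}e^{βnd}∏(1-q_i t_i^n)^{d n_i}; stated per degree, n integer, t_i not 0 or a root of unity, q_i t_i^n≠1, s_λ(p(0,t_i))≠0, a fixed branch for complex n_i, multinomial sums over c absolutely convergent. *)

(* Defs.v *)
(* MathComp / MathComp-Analysis; the field of complex numbers is R[i] for
   R : realType, topologized as R[i]^o. *)
From HB Require Import structures.
From mathcomp Require Import all_boot all_order all_algebra all_fingroup.
From mathcomp Require Import all_field all_character all_real_closed.
From mathcomp Require Import all_classical all_reals all_analysis.
From mathcomp.analysis.showcase Require Import summability.
Set Implicit Arguments.
Unset Strict Implicit.
Unset Printing Implicit Defensive.
Import Order.TTheory GRing.Theory Num.Theory numFieldNormedType.Exports.
Local Open Scope ring_scope.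

Section ComplexFunctions.
Variable R : realType.
Implicit Types (z a v : R[i]).

Definition Cmod z : R := Num.sqrt (complex.Re z ^+ 2 + complex.Im z ^+ 2).

Definition Cexp z : R[i] :=
  ((expR (complex.Re z) * cos (complex.Im z))
   +i* (expR (complex.Re z) * sin (complex.Im z)))%C.

(* Principal argument, in ]-pi, pi]; only meaningful for z != 0. *)
Definition Carg z : R :=
  if 0 <= complex.Im z then acos (complex.Re z / Cmod z)
  else - acos (complex.Re z / Cmod z).

Definition Clog z : R[i] := (ln (Cmod z) +i* Carg z)%C.

(* z ^ v for a complex exponent v, computed with the branch of the logarithm
   that has its cut on the ray opposite to a != 0 and takes the principal value
   at a.  The principal branch is a = 1; for v an integer and z != 0 the value
   is the integer power of z whatever a is. *)
Definition Cpow a z v : R[i] :=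
  if z == 0 then (v == 0)%:R else Cexp (v * (Clog a + Clog (z / a))).

Definition abs_summable (I : choiceType) (f : I -> R[i]) : Prop :=
  esum.summable [set: I]%classic (fun x => (Cmod (f x))%:E).

(* The limit of the sums over finite subsets of I, directed by inclusion. *)
Definition Csum (I : choiceType) (f : I -> R[i]) : R[i] :=
  summability.sum (f : I -> R[i]^o).

End ComplexFunctions.

(* A partition of d: d weakly decreasing naturals of sum d, zeros included. *)
Definition is_intpart d (u : d.-tuple 'I_d.+1) : bool :=
  sorted geq [seq val x | x <- u] && (sumn [seq val x | x <- u] == d).

Record intpart d := IntPart
  { intpart_val : d.-tuple 'I_d.+1; _ : is_intpart intpart_val }.
HB.instance Definition _ d := [isSub for @intpart_val d].
HB.instance Definition _ d := [Finite of intpart d by <:].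

Definition parts d (la : intpart d) : seq nat :=
  [seq x <- [seq val x | x <- intpart_val la] | (0 < x)%N].

Definition plength d (la : intpart d) : nat := size (parts la).

Definition nontriv d := {Delta : intpart d | parts Delta != nseq d 1%N}.

Section SymmetricCharacters.
Variable d : nat.
Implicit Types la : intpart d.

(* The cells of the diagram of la are numbered 0, ..., d-1 in reading order. *)
Definition cell_row la (x : 'I_d) : nat := reshape_index (parts la) x.
Definition cell_col la (x : 'I_d) : nat := reshape_offset (parts la) x.

Definition fiber_stab (h : 'I_d -> nat) : {set 'S_d} :=
  [set s : 'S_d | [forall x, h (s x) == h x]].

Lemma fiber_stab_group_set h : group_set (fiber_stab h).
Proof.
apply/group_setP; split=> [|s u].
  by rewrite inE; apply/forallP => x; rewrite perm1.
rewrite !inE => /forallP hs /forallP hu; apply/forallP => x.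
by rewrite permM (eqP (hu _)) (eqP (hs _)).
Qed.
Canonical fiber_stab_group h := Group (fiber_stab_group_set h).

Definition sign_mx (s : 'S_d) : 'M[algC]_1 := ((-1) ^+ s)%:M.

Lemma sign_mx_repr : mx_repr [set: 'S_d] sign_mx.
Proof.
split=> [|s u _ _]; first by rewrite /sign_mx odd_perm1.
by rewrite /sign_mx odd_permM signr_addb scalar_mxM.
Qed.

Definition sign_char : 'CF([set: 'S_d]) :=
  cfRepr (MxRepresentation sign_mx_repr).

(* chi_la is the unique irreducible character of S_d that is a constituent both
   of the character induced from the trivial one of the row stabilizer and of
   the character induced from the sign of the column stabilizer.  With this
   convention chi_(d) is the trivial character. *)
Definition irr_label la : Iirr [set: 'S_d] :=
  odflt 0 [pick i |
    (i \in irr_constt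
       ('Ind[[set: 'S_d]] (1 : 'CF(fiber_stab_group (cell_row la)))))
    && (i \in irr_constt
       ('Ind[[set: 'S_d]] ('Res[fiber_stab_group (cell_col la)] sign_char)))].

(* Empty when Delta does not have sum d. *)
Definition sym_class (Delta : seq nat) : {set 'S_d} :=
  [set s : 'S_d | perm_eq [seq #|(X : {set 'I_d})| | X <- enum (porbits s)] Delta].

End SymmetricCharacters.

(* The partition (2, 1^(d-2)).  For d < 2 no permutation in S_d has this cycle
   type, hence its class is empty and all the terms |C_Gamma| chi vanish. *)
Definition Gamma d : seq nat := 2%N :: nseq (d - 2) 1%N.

Section HurwitzSums.
Variable R : realType.
Local Notation C := R[i].

(* The characters of S_d take integer values, so that taking the floor only
   transports them from algC to R[i]. *)
Definition to_complex (x : algC) : C := (Num.floor x)%:~R.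

Section FixedDegree.
Variable d : nat.
Implicit Types la : intpart d.

Definition chi la (Delta : seq nat) : C :=
  to_complex ('chi_(irr_label la) (repr (sym_class d Delta))).

Definition chi1 la : C := to_complex ('chi_(irr_label la) 1%g).

Definition class_card (Delta : seq nat) : C := #|sym_class d Delta|%:R.

Definition phi la (Delta : seq nat) : C :=
  class_card Delta * (chi la Delta / chi1 la).

Definition psum_prod (p : nat -> C) (Delta : intpart d) : C :=
  \prod_(m <- parts Delta) p m.

Definition schur la (p : nat -> C) : C :=
  (d`!)%:R^-1 *
  \sum_(Delta : intpart d)
     class_card (parts Delta) * chi la (parts Delta) * psum_prod p Delta.

Definition hurwitz (E : int) (N : nat) (args : seq (seq nat)) : C :=
  (d`!)%:R *
  \sum_(la : intpart d | (plength la <= N)%N)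
     (\prod_(Delta <- args) phi la Delta) * (chi1 la / (d`!)%:R) ^ E.

Definition content_f la (n : int) : C := n%:~R * d%:R + phi la (Gamma d).

Definition weight (Delta : intpart d) (Q t : C) : C :=
  ((1 - t) / (1 - Q)) ^+ d *
  \prod_(m <- parts Delta) ((1 - Q ^+ m) / (1 - t ^+ m)).

Definition rising (x : C) (m : nat) : C := \prod_(j < m) (x + j%:R).

Definition family := {ffun nontriv d -> nat}.

Definition family_size (c : family) : nat := (\sum_(Delta : nontriv d) c Delta)%N.

Definition W (nu Q t : C) (c : family) : C :=
  (-1) ^+ family_size c * rising (- nu) (family_size c) *
  \prod_(Delta : nontriv d) (weight (val Delta) Q t ^+ c Delta / (c Delta)`!%:R).

End FixedDegree.

Definition p_Qt (Q t : C) (m : nat) : C := (1 - Q ^+ m) / (1 - t ^+ m).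

(* The data of c^i and \bar c^i for all i, as pairs. *)
Definition families d k := {ffun 'I_k -> family d * family d}.

Definition L_args d k F (cs : families d k) (b : nat)
    (Ds : {ffun 'I_F -> intpart d}) : seq (seq nat) :=
  flatten [seq nseq (\sum_(i < k) ((cs i).1 D + (cs i).2 D)) (parts (val D))
          | D <- enum {: nontriv d}]
  ++ nseq b (Gamma d) ++ [seq parts (Ds j) | j <- enum 'I_F].

Definition L_term d k F (E : int) (N : nat) (nu Q t : 'I_k -> C) (b : nat)
    (Ds : {ffun 'I_F -> intpart d}) (cs : families d k) : C :=
  hurwitz d E N (L_args cs b Ds) *
  \prod_(i < k) (W (nu i) (Q i) (t i) (cs i).1 * W (- nu i) 0 (t i) (cs i).2).

Definition L d k F (E : int) (N : nat) (nu Q t : 'I_k -> C) (b : nat)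
    (Ds : {ffun 'I_F -> intpart d}) : C :=
  Csum (L_term E N nu Q t b Ds).

(* For complex nu i the power is taken with the branch attached to (1 - Q)^d,
   the limit of schur la (p_Qt Q t) / schur la (p_Qt 0 t) as t tends to 1 with
   Q fixed; this choice is immaterial when the nu i are integers. *)
Definition r_factor d k (la : intpart d) (n : int) (q t nu : 'I_k -> C)
    (beta : C) : C :=
  Cexp (beta * content_f la n) *
  \prod_(i < k)
     Cpow ((1 - q i * t i ^ n) ^+ d)
       (schur la (p_Qt (q i * t i ^ n) (t i)) / schur la (p_Qt 0 (t i)))
       (nu i).

(* The homogeneous component of tau in degree d = |la|. *)
Definition tau d k F (E : int) (N : nat) (n : int) (p : 'I_F -> nat -> C)
    (q t nu : 'I_k -> C) (beta : C) : C :=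
  \sum_(la : intpart d | (plength la <= N)%N)
     r_factor la n q t nu beta * chi1 la ^ (E - F%:Z) *
     \prod_(j < F) schur la (p j).

(* The scalar d!^(E-F-1) e^(beta n d) \prod_i (1 - q_i t_i^n)^(d n_i), which
   depends on d but not on la: the three factors come from
   dim(la)^(E-F) against (dim(la)/d!)^E d!, from the summand n |la| of
   content_f, and from the coefficients of p_1^d in the two Schur functions. *)
Definition degree_factor d k F (E n : int) (q t nu : 'I_k -> C) (beta : C) : C :=
  (d`!)%:R ^ (E - F%:Z - 1) * Cexp (beta * (n%:~R * d%:R)) *
  \prod_(i < k)
     Cpow ((1 - q i * t i ^ n) ^+ d) ((1 - q i * t i ^ n) ^+ d) (nu i).

(* The two multinomial expansions that the sum defining L is a product of,
   evaluated at la. *)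
Definition W_term d (la : intpart d) (nu Q t : C) (c : family d) : C :=
  W nu Q t c * \prod_(D : nontriv d) phi la (parts (val D)) ^+ c D.

End HurwitzSums.

(* Main.v *)
(* Up to powers of d!, a Schur function is chi(1) \sum_Delta phi_la(Delta) p_Delta,
   and phi_la(1^d) = 1; hence the quotient of two of them that occurs in r_la is
   (1 - Q)^d (1 + X) / (1 + Y) with X = \sum w_Delta(Q, t) phi_la(Delta) and Y the
   same sum at Q = 0, both over Delta <> (1^d).  The families W(nu, Q, t, c) and
   W(-nu, 0, t, c) are the coefficients of the multinomial expansions of
   (1 + X)^nu and (1 + Y)^(-nu), and absolute summability is just what makes
   these expansions converge to the powers.  Summing L over the families thus
   gives a finite sum over la of products, in which b only occurs through
   phi_la(Gamma)^b: the sum over b is an exponential series.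

   The binomial and exponential series are both summed by following their
   partial sums P_M along the segment from 0 to the point considered: P_M solves
   the differential equation of the limit up to an error term of degree M. *)
Require Import Defs.
From mathcomp Require Import all_boot all_order all_algebra all_fingroup.
From mathcomp Require Import all_field all_character all_real_closed.
From mathcomp Require Import all_classical all_reals all_analysis.
From mathcomp.analysis.showcase Require Import summability.
From mathcomp Require Import ring lra zify finmap.
Import Order.TTheory GRing.Theory Num.Theory numFieldNormedType.Exports.
Local Open Scope classical_set_scope.
Local Open Scope ring_scope.
Set Implicit Arguments.
Unset Strict Implicit.
Unset Printing Implicit Defensive.

(** * Complex exponential and logarithm *)

Section ComplexNumbers.
Variable R : realType.
Local Notation C := R[i].
Local Notation Re := complex.Re.
Local Notation Im := complex.Im.
Implicit Types (z w u v nu X : C) (x y s : R).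

Lemma Cmod_normc z : Cmod z = Normc.normc z.
Proof. by case: z. Qed.

Lemma normCE z : `|z| = (Cmod z)%:C%C.
Proof. exact: normc_def. Qed.

Lemma CmodM z w : Cmod (z * w) = Cmod z * Cmod w.
Proof. by rewrite !Cmod_normc Normc.normcM. Qed.

Lemma Cmod_triangle z w : Cmod (z + w) <= Cmod z + Cmod w.
Proof. by rewrite !Cmod_normc le_normcD. Qed.

Lemma Cmod_ge0 z : 0 <= Cmod z. Proof. exact: sqrtr_ge0. Qed.

Lemma CmodN z : Cmod (- z) = Cmod z.
Proof. by rewrite !Cmod_normc normcN. Qed.

Lemma CmodB z w : Cmod (z - w) = Cmod (w - z).
Proof. by rewrite -CmodN opprB. Qed.

Lemma Cmod0 : Cmod (0 : C) = 0.
Proof. by rewrite Cmod_normc Normc.normc0. Qed.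

Lemma Cmod1 : Cmod (1 : C) = 1.
Proof. by rewrite Cmod_normc Normc.normc1. Qed.

Lemma Cmod_eq0 z : (Cmod z == 0) = (z == 0).
Proof.
apply/eqP/eqP => [|->]; last exact: Cmod0.
by rewrite Cmod_normc; exact: Normc.eq0_normc.
Qed.

Lemma Cmod_gt0 z : (0 < Cmod z) = (z != 0).
Proof. by rewrite lt0r Cmod_eq0 Cmod_ge0 andbT. Qed.

Lemma CmodV z : Cmod z^-1 = (Cmod z)^-1.
Proof. by rewrite !Cmod_normc Normc.normcV. Qed.

Lemma CmodX z n : Cmod (z ^+ n) = Cmod z ^+ n.
Proof. by elim: n => [|n IH]; rewrite ?Cmod1// !exprS CmodM IH. Qed.

Lemma Cmod_prod (I : Type) (r : seq I) (P : pred I) (F : I -> C) :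
  Cmod (\prod_(i <- r | P i) F i) = \prod_(i <- r | P i) Cmod (F i).
Proof. by apply: (big_morph _ CmodM Cmod1). Qed.

Lemma Cmod_sum (I : Type) (r : seq I) (P : pred I) (F : I -> C) :
  Cmod (\sum_(i <- r | P i) F i) <= \sum_(i <- r | P i) Cmod (F i).
Proof.
elim/big_rec2: _ => [|i y z _ h]; first by rewrite Cmod0.
by apply: le_trans (Cmod_triangle _ _) _; rewrite lerD2l.
Qed.

Lemma Cmod_real x : Cmod x%:C%C = `|x|.
Proof. by rewrite /Cmod /= expr0n addr0 sqrtr_sqr. Qed.

Lemma Cmod_nat n : Cmod (n%:R : C) = n%:R.
Proof.
have -> : (n%:R : C) = (n%:R : R)%:C%C by rewrite rmorph_nat.
by rewrite Cmod_real ger0_norm.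
Qed.

Lemma Cmod_sqr z : Cmod z ^+ 2 = Re z ^+ 2 + Im z ^+ 2.
Proof. by rewrite sqr_sqrtr// addr_ge0 ?sqr_ge0. Qed.

Lemma Re_le_Cmod z : `|Re z| <= Cmod z.
Proof. by rewrite -sqrtr_sqr ler_wsqrtr// lerDl sqr_ge0. Qed.

Lemma Im_le_Cmod z : `|Im z| <= Cmod z.
Proof. by rewrite -sqrtr_sqr ler_wsqrtr// lerDr sqr_ge0. Qed.

Lemma Cmod_le z : Cmod z <= `|Re z| + `|Im z|.
Proof.
rewrite -[leRHS]ger0_norm ?addr_ge0// -sqrtr_sqr ler_wsqrtr// sqrrD.
by rewrite !real_normK ?num_real// lerD2r lerDl mulrn_wge0 ?mulr_ge0.
Qed.

Lemma complex_eqP z w : Re z = Re w -> Im z = Im w -> z = w.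
Proof. by case: z w => [a b] [c d] /= -> ->. Qed.

Lemma ReD z w : Re (z + w) = Re z + Re w. Proof. by case: z w => [? ?] []. Qed.
Lemma ImD z w : Im (z + w) = Im z + Im w. Proof. by case: z w => [? ?] []. Qed.
Lemma ReN z : Re (- z) = - Re z. Proof. by case: z. Qed.
Lemma ImN z : Im (- z) = - Im z. Proof. by case: z. Qed.
Lemma ReM z w : Re (z * w) = Re z * Re w - Im z * Im w.
Proof. by case: z w => [? ?] []. Qed.
Lemma ImM z w : Im (z * w) = Re z * Im w + Im z * Re w.
Proof. by case: z w => [? ?] []. Qed.

Lemma CexpD z w : Cexp (z + w) = Cexp z * Cexp w.
Proof.
apply: complex_eqP; rewrite ?ReM ?ImM /Cexp /= ReD ImD expRD ?cosD ?sinD; ring.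
Qed.

Lemma Cexp0 : Cexp (0 : C) = 1.
Proof. by rewrite /Cexp /= expR0 cos0 sin0 mulr1 mulr0. Qed.

Lemma Cexp_neq0 z : Cexp z != 0.
Proof.
apply/eqP => h; have := Cexp0; rewrite -(subrr z) CexpD h mul0r.
by move/esym/eqP; rewrite oner_eq0.
Qed.

Lemma CexpN z : Cexp (- z) = (Cexp z)^-1.
Proof.
by apply: (mulfI (Cexp_neq0 z)); rewrite -CexpD subrr Cexp0 divff ?Cexp_neq0.
Qed.

Lemma CexpMn z n : Cexp (n%:R * z) = Cexp z ^+ n.
Proof.
elim: n => [|n IH]; first by rewrite mul0r Cexp0.
by rewrite -natr1 mulrDl mul1r CexpD IH exprSr.
Qed.

Lemma Cmod_Cexp z : Cmod (Cexp z) = expR (Re z).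
Proof.
rewrite /Cmod /Cexp /= !exprMn -mulrDr cos2Dsin2 mulr1 sqrtr_sqr.
by rewrite ger0_norm// expR_ge0.
Qed.

Lemma cos_Carg z : z != 0 -> cos (Carg z) = Re z / Cmod z.
Proof.
rewrite -Cmod_gt0 => z0.
have h : -1 <= Re z / Cmod z <= 1.
  by rewrite -ler_norml normrM normfV (gtr0_norm z0) ler_pdivrMr// mul1r Re_le_Cmod.
by rewrite /Carg; case: ifP => _; rewrite ?cosN acosK.
Qed.

(** An [acos] has nonnegative sine, here [|Im z| / Cmod z]; the sign test in [Carg] restores the
    sign. *)
Lemma sin_Carg z : z != 0 -> sin (Carg z) = Im z / Cmod z.
Proof.
rewrite -Cmod_gt0 => z0.
have h : -1 <= Re z / Cmod z <= 1.
  by rewrite -ler_norml normrM normfV (gtr0_norm z0) ler_pdivrMr// mul1r Re_le_Cmod.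
have e : sin (acos (Re z / Cmod z)) = `|Im z| / Cmod z.
  rewrite sin_acos// -[RHS]ger0_norm; last by rewrite divr_ge0// Cmod_ge0.
  rewrite -sqrtr_sqr; congr Num.sqrt.
  rewrite !exprMn !exprVn real_normK ?num_real// Cmod_sqr.
  have : 0 < Re z ^+ 2 + Im z ^+ 2 by rewrite -Cmod_sqr exprn_gt0.
  by move=> /lt0r_neq0 ?; field.
rewrite /Carg; case: ifP => [im0|/negbT]; first by rewrite e ger0_norm.
by rewrite -ltNge => im0; rewrite sinN e ltr0_norm// mulNr opprK.
Qed.

Lemma ClogK z : z != 0 -> Cexp (Clog z) = z.
Proof.
move=> z0; have p : 0 < Cmod z by rewrite Cmod_gt0.
by apply: complex_eqP; rewrite /Cexp /= lnK ?posrE// ?cos_Carg ?sin_Carg//;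
  rewrite mulrC divfK// lt0r_neq0.
Qed.

(** On this strip [acos] recovers [Im z] up to sign, and the sign is that of the sine, which is what
    [Carg] tests. *)
Lemma CexpK z : - pi < Im z < pi -> Clog (Cexp z) = z.
Proof.
case: z => x y /= /andP[h1 h2].
apply: complex_eqP; rewrite /Clog /=; first by rewrite Cmod_Cexp /= expRK.
rewrite /Carg Cmod_Cexp /= pmulr_rge0 ?expR_gt0//.
rewrite mulrAC divff ?gt_eqF ?expR_gt0// mul1r.
have [y0|y0] := leP 0 y.
  rewrite sin_ge0_pi ?y0 ?ltW//.
  by rewrite cosK// in_itv /= y0 ltW.
have : sin y < 0.
  by rewrite -oppr_gt0 -sinN sin_gt0_pi// oppr_gt0 y0 /= ltrNl.
rewrite ltNge => /negbTE ->.
by rewrite -cosN cosK ?opprK// in_itv /= oppr_ge0 ltW//= ltW// ltrNl.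
Qed.

Lemma Clog1 : Clog (1 : C) = 0.
Proof. by rewrite -Cexp0 CexpK//= oppr_lt0 pi_gt0. Qed.

(** The cosine decreases on [0, pi], so an [acos] of at least pi/2 would make [Re z / Cmod z]
    nonpositive. *)
Lemma Carg_ltpihalf z : 0 < Re z -> `|Carg z| < pi / 2.
Proof.
move=> r0.
have z0 : 0 < Cmod z by apply: lt_le_trans (Re_le_Cmod z); rewrite gtr0_norm.
have h : -1 <= Re z / Cmod z <= 1.
  by rewrite -ler_norml normrM normfV (gtr0_norm z0) ler_pdivrMr// mul1r Re_le_Cmod.
have -> : `|Carg z| = acos (Re z / Cmod z).
  by rewrite /Carg; case: ifP => _; rewrite ?normrN ger0_norm// acos_ge0.
rewrite ltNge; apply/negP => h2.
have : cos (acos (Re z / Cmod z)) <= cos (pi / 2).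
  rewrite leNgt ltr_cos ?in_itv/= ?acos_ge0 ?acos_lepi// -?leNgt//.
  have := @pi_gt0 R; lra.
by rewrite acosK// cos_pihalf leNgt divr_gt0.
Qed.

(** Both arguments lie strictly between -pi/2 and pi/2, so their difference stays in the strip of
    [CexpK] and no multiple of 2 pi is lost. *)
Lemma Clog_div u v : 0 < Re u -> 0 < Re v -> Clog (u / v) = Clog u - Clog v.
Proof.
move=> u0 v0.
have nz z : 0 < Re z -> z != 0.
  by move=> r0; rewrite -Cmod_gt0 (lt_le_trans _ (Re_le_Cmod z))// gtr0_norm.
rewrite -{1}(ClogK (nz _ u0)) -{1}(ClogK (nz _ v0)) -CexpN -CexpD CexpK//.
rewrite ImD ImN /=.
have := Carg_ltpihalf u0; have := Carg_ltpihalf v0; rewrite !ltr_norml; lra.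
Qed.

(** The closed unit disc around 1 meets the imaginary axis only at the origin, so -1 is the only
    point of the disc of convergence to be treated apart. *)
Lemma Re1D_gt0_or_eq0 z : Cmod z <= 1 -> 1 + z = 0 \/ 0 < Re (1 + z).
Proof.
move=> z1; have [|z0] := eqVneq (1 + z) 0; [by left|right].
rewrite ReD lt_neqAle; apply/andP; split; last first.
  by rewrite -lerBlDl sub0r; have := le_trans (Re_le_Cmod z) z1; rewrite ler_norml => /andP[].
apply: contra_neq z0 => h; apply: complex_eqP; rewrite ?ReD ?ImD /= ?add0r//.
have : Cmod z ^+ 2 <= 1 by rewrite expr_le1 ?Cmod_ge0.
have Rez : Re z = -1 by apply/eqP; rewrite -addr_eq0 addrC; apply/eqP.
rewrite Cmod_sqr Rez sqrrN expr1n gerDl => h2.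
by apply/eqP; rewrite -sqrf_eq0 eq_le h2 sqr_ge0.
Qed.

End ComplexNumbers.

(** * Power series along a real segment *)

Section ComplexDerivatives.
Variable R : realType.
Local Notation C := R[i].
Local Notation Re := complex.Re.
Local Notation Im := complex.Im.
Implicit Types (z w u v nu X a : C) (x y s : R) (f g h : R -> C).

(** Working coordinatewise reduces every rule to real derivatives and gives access to the real mean
    value theorem. *)
Definition cderiv f (df : C) s : Prop :=
  is_derive s (1 : R) (fun x => Re (f x)) (Re df) /\
  is_derive s (1 : R) (fun x => Im (f x)) (Im df).

Lemma cderiv_eq f g df dg s : f =1 g -> df = dg -> cderiv f df s -> cderiv g dg s.
Proof. by move=> /funext -> ->. Qed.

Lemma cderivD f g df dg s :
  cderiv f df s -> cderiv g dg s -> cderiv (fun x => f x + g x) (df + dg) s.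
Proof.
move=> [f1 f2] [g1 g2]; split.
  rewrite (_ : (fun x => _) = (fun x => Re (f x)) + (fun x => Re (g x))).
    by rewrite ReD; apply: is_deriveD.
  by apply/funext => x; rewrite ReD.
rewrite (_ : (fun x => _) = (fun x => Im (f x)) + (fun x => Im (g x))).
  by rewrite ImD; apply: is_deriveD.
by apply/funext => x; rewrite ImD.
Qed.

Lemma cderivM f g df dg s :
  cderiv f df s -> cderiv g dg s ->
  cderiv (fun x => f x * g x) (f s * dg + df * g s) s.
Proof.
move=> [f1 f2] [g1 g2]; split.
  rewrite (_ : (fun x => _) = (fun x => Re (f x)) * (fun x => Re (g x))
            - (fun x => Im (f x)) * (fun x => Im (g x))).
    by apply: is_derive_eq; rewrite !ReD !ReM /GRing.scale /=; ring.
  by apply/funext => x; rewrite ReM.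
rewrite (_ : (fun x => _) = (fun x => Re (f x)) * (fun x => Im (g x))
          + (fun x => Im (f x)) * (fun x => Re (g x))).
  by apply: is_derive_eq; rewrite !ImD !ImM /GRing.scale /=; ring.
by apply/funext => x; rewrite ImM.
Qed.

Lemma cderiv_cst a s : cderiv (fun=> a) 0 s.
Proof. by split; exact: is_derive_cst. Qed.

Lemma cderiv_id s : cderiv (fun x => x%:C%C) 1 s.
Proof. by split; [exact: is_derive_id|exact: is_derive_cst]. Qed.

Lemma cderivZ a f df s : cderiv f df s -> cderiv (fun x => a * f x) (a * df) s.
Proof.
move=> h; apply: cderiv_eq (cderivM (cderiv_cst a s) h) => //.
by rewrite mul0r addr0.
Qed.

Lemma cderivX n s :
  cderiv (fun x => x%:C%C ^+ n.+1) (n.+1%:R * s%:C%C ^+ n) s.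
Proof.
elim: n => [|n IH]; first by rewrite mul1r; exact: cderiv_id.
apply: cderiv_eq (cderivM (cderiv_id s) IH) => [x|]; first by rewrite -exprS.
by rewrite -[n.+2%:R]natr1 mulrDl !mul1r mulrCA -exprS.
Qed.

Lemma cderiv_exp f df s :
  cderiv f df s -> cderiv (fun x => Cexp (f x)) (Cexp (f s) * df) s.
Proof.
move=> [f1 f2]; split; rewrite /Cexp /=.
  rewrite (_ : (fun x => _) = (expR \o (fun x => Re (f x))) * (cos \o (fun x => Im (f x)))).
    apply: is_derive_eq; rewrite ReM /= /GRing.scale /=; ring.
  by [].
rewrite (_ : (fun x => _) = (expR \o (fun x => Re (f x))) * (sin \o (fun x => Im (f x)))).
  apply: is_derive_eq; rewrite ImM /= /GRing.scale /=; ring.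
by [].
Qed.

Lemma within_continuous_derive (g dg : R -> R) (a b : R) :
  {in `[a, b], forall s, is_derive s (1 : R) g (dg s)} ->
  {within `[a, b], continuous g}.
Proof.
move=> dg01; apply: derivable_within_continuous => x xI.
by have [] := dg01 _ xI.
Qed.

(** The mean value theorem is applied to [g] minus the primitive of [K * s ^+ M], whose derivative
    is nonpositive. *)
Lemma derive_le_power (g dg : R -> R) (K : R) (M : nat) :
  {in `[0, 1], forall s, is_derive s (1 : R) g (dg s)} ->
  {in `[0, 1], forall s, dg s <= K * s ^+ M} ->
  g 1 - g 0 <= K / M.+1%:R.
Proof.
move=> gd gK.
pose h := g - (fun s => K / M.+1%:R * s ^+ M.+1) : R -> R.
have hd (s : R) : s \in `[0, 1] -> is_derive s (1 : R) h (dg s - K * s ^+ M).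
  move=> sI; have ? := gd _ sI; rewrite /h.
  have -> : (fun s => K / M.+1%:R * s ^+ M.+1) = (K / M.+1%:R) *: (@id R ^+ M.+1).
    by rewrite exprfctE.
  apply: is_derive_eq; rewrite /GRing.scale /= mulr1.
  have : (M.+1%:R : R) != 0 by rewrite pnatr_eq0.
  by move=> ?; congr (_ - _); field.
have hd' x : x \in `]0, 1[%R -> is_derive x (1 : R) h (dg x - K * x ^+ M).
  by move=> /subset_itv_oo_cc; exact: hd.
have hc : {within `[0, 1], continuous h} by apply: within_continuous_derive hd.
have [c cI] := MVT ltr01 hd' hc.
have -> : h 1 = g 1 - K / M.+1%:R by rewrite /h !fctE expr1n mulr1.
have -> : h 0 = g 0 by rewrite /h !fctE expr0n mulr0 subr0.
have : dg c - K * c ^+ M <= 0.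
  by rewrite subr_le0; apply: gK; exact: subset_itv_oo_cc cI.
rewrite subr0 mulr1 => + e; rewrite -e => {e}.
by rewrite addrAC subr_le0.
Qed.

(** The mean value theorem fails for complex values; it is used on each coordinate, with both signs,
    at the price of a factor 2. *)
Lemma cderiv_le_power f (df : R -> C) (K : R) (M : nat) :
  {in `[0, 1], forall s, cderiv f (df s) s} ->
  {in `[0, 1], forall s, Cmod (df s) <= K * s ^+ M} ->
  Cmod (f 1 - f 0) <= K / M.+1%:R *+ 2.
Proof.
move=> fd fK; apply: le_trans (Cmod_le _) _.
have key (p : C -> R) : (forall s, s \in `[0, 1] ->
      is_derive s (1 : R) (fun x => p (f x)) (p (df s))) ->
    (forall z, `|p z| <= Cmod z) -> `|p (f 1) - p (f 0)| <= K / M.+1%:R.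
  move=> pd pc; rewrite ler_norml; apply/andP; split.
    rewrite lerNl opprB addrC -[p (f 0)]opprK.
    apply: (@derive_le_power (fun x => - p (f x)) (fun s => - p (df s))) => s sI.
      by have ? := pd _ sI; apply: is_deriveN.
    by apply: le_trans (fK _ sI); apply: le_trans (pc _); rewrite -normrN ler_norm.
  apply: (@derive_le_power (fun x => p (f x)) (fun s => p (df s))) => s sI.
    exact: pd.
  by apply: le_trans (fK _ sI); apply: le_trans (pc _); rewrite ler_norm.
rewrite mulr2n ReD ReN ImD ImN; apply: lerD.
  exact: (key (@complex.Re R) (fun s sI => (fd s sI).1) (@Re_le_Cmod R)).
exact: (key (@complex.Im R) (fun s sI => (fd s sI).2) (@Im_le_Cmod R)).
Qed.

(** The norm of [R[i]^o] takes values in [R[i]], where a positive epsilon is necessarily real; this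
    moves convergence over to [R]. *)
Lemma cvg_Cmod (T : Type) (F : set_system T) (FF : Filter F) (u : T -> C) (l : C) :
  ((u : T -> C^o) @ F --> (l : C^o)) <-> ((fun n => Cmod (u n - l)) @ F --> (0 : R)).
Proof.
split=> [/cvgrPdist_lt h|/cvgrPdist_lt h]; apply/cvgrPdist_lt => e e0.
  have e0' : 0 < e%:C%C by rewrite ltcR.
  apply: filterS (h _ e0') => x; rewrite normCE ltcR sub0r normrN CmodB.
  by rewrite ger0_norm// Cmod_ge0.
have eE : e = (Re e)%:C%C by rewrite RRe_real// gtr0_real.
have e0' : 0 < Re e by rewrite -ltcR -eE.
apply: filterS (h _ e0') => x; rewrite sub0r normrN ger0_norm ?Cmod_ge0//.
by rewrite -ltcR -eE CmodB -normCE.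
Qed.

(* The derivative of P M * Cexp (- w) is r M * s ^ M times a bounded function,
   so that P M 1 * Cexp (- w 1) differs from 1 by O(r M / (M + 1)). *)
Lemma ode_approx (P : nat -> R -> C) (dP : nat -> R -> C) (w dw v : R -> C)
    (r : nat -> C) (K : R) :
  (forall M, P M 0 = 1) -> w 0 = 0 ->
  (forall M, {in `[0, 1], forall s, cderiv (P M) (dP M s) s}) ->
  {in `[0, 1], forall s, cderiv w (dw s) s} ->
  (forall M, {in `[0, 1], forall s, dP M s = P M s * dw s + r M * s%:C%C ^+ M * v s}) ->
  {in `[0, 1], forall s, Cmod (v s * Cexp (- w s)) <= K} ->
  (fun M => Cmod (r M) / M.+1%:R) @ \oo --> (0 : R) ->
  (fun M => P M 1 : C^o) @ \oo --> (Cexp (w 1) : C^o).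
Proof.
move=> P0 w0 Pd wd Peq vK r0; apply/cvg_Cmod.
have K0 : 0 <= K.
  by apply: le_trans (vK 0 _); rewrite ?Cmod_ge0// in_itv /= lexx ler01.
have bnd M : Cmod (P M 1 - Cexp (w 1)) <=
    (K *+ 2 * Cmod (Cexp (w 1))) * (Cmod (r M) / M.+1%:R).
  have -> : P M 1 - Cexp (w 1) = Cexp (w 1) * (P M 1 * Cexp (- w 1) - 1).
    by rewrite mulrBr mulrCA -CexpD subrr Cexp0 !mulr1.
  rewrite CmodM mulrAC mulrC; apply: ler_wpM2r; first exact: Cmod_ge0.
  pose h s := P M s * Cexp (- w s).
  have h0 : h 0 = 1 by rewrite /h P0 w0 oppr0 Cexp0 mulr1.
  rewrite -/(h 1) -h0.
  have -> : K *+ 2 * (Cmod (r M) / M.+1%:R) = (Cmod (r M) * K) / M.+1%:R *+ 2.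
    by rewrite mulrnAl mulrCA mulrA.
  apply: (@cderiv_le_power _
    (fun s => P M s * (Cexp (- w s) * (- 1 * dw s)) + dP M s * Cexp (- w s))).
    move=> s sI; apply: cderivM; first exact: Pd.
    have := cderivZ (-1) (wd _ sI).
    rewrite (_ : (fun x => -1 * w x) = (fun x => - w x)).
      exact: (@cderiv_exp (fun x => - w x)).
    by apply/funext => x; rewrite mulN1r.
  move=> s sI; rewrite (Peq _ _ sI).
  (* The two terms containing [P M s * dw s] cancel: only the error term of the equation
     survives. *)
  rewrite (_ : _ + _ = r M * (v s * Cexp (- w s)) * s%:C%C ^+ M); last by ring.
  rewrite !CmodM CmodX Cmod_real -!mulrA.
  rewrite ger0_norm; last by move: sI; rewrite in_itv => /andP[].
  apply: ler_wpM2l; first exact: Cmod_ge0.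
  rewrite mulrA -CmodM; apply: ler_wpM2r; last exact: vK.
  by rewrite exprn_ge0//; move: sI; rewrite in_itv => /andP[].
apply: (@squeeze_cvgr _ _ _ _ (fun=> 0)
  (fun M => (K *+ 2 * Cmod (Cexp (w 1))) * (Cmod (r M) / M.+1%:R))).
- by apply: nearW => M; rewrite Cmod_ge0 bnd.
- exact: cvg_cst.
- by rewrite -[X in _ --> X](mulr0 (K *+ 2 * Cmod (Cexp (w 1)))); apply: cvgMr.
Qed.

(** The truncation [P M] of exp(s z) satisfies P' = z P + r s^M, where r is minus z^(M+1) / M!.
    Divided by M + 1, the modulus of r is the exponential coefficient of index M + 1, which tends to
    0. *)
Lemma Cexp_series z :
  (fun M => \sum_(m < M.+1) (z ^+ m / m`!%:R) : C^o) @ \oo --> (Cexp z : C^o).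
Proof.
pose P M (s : R) := \sum_(m < M.+1) (z ^+ m / m`!%:R) * s%:C%C ^+ m.
pose r M := - z * (z ^+ M / M`!%:R).
have Pd M s : cderiv (P M) (P M s * z + r M * s%:C%C ^+ M * 1) s.
  elim: M => [|M IH].
    apply: cderiv_eq (cderiv_cst 1 s) => [x|]; rewrite /P big_ord1 !expr0 ?fact0.
      by rewrite mulr1 divr1.
    by rewrite /r expr0 fact0 divr1 !mulr1 mul1r subrr.
  have h := cderivD IH (cderivZ (z ^+ M.+1 / M.+1`!%:R) (cderivX M s)).
  apply: cderiv_eq h => [x|]; first by rewrite /P [RHS]big_ord_recr.
  rewrite /P [in RHS]big_ord_recr /= /r factS natrM !exprS.
  have : (M`!%:R : C) != 0 by rewrite pnatr_eq0 -lt0n fact_gt0.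
  have : (M.+1%:R : C) != 0 by rewrite pnatr_eq0.
  by rewrite -natr1 => ? ?; field; apply/andP.
have -> : (fun M => \sum_(m < M.+1) (z ^+ m / m`!%:R) : C^o) = (fun M => P M 1 : C^o).
  by apply/funext => M; apply: eq_bigr => m _; rewrite expr1n mulr1.
have -> : Cexp z = Cexp (z * (1 : R)%:C%C) by rewrite mulr1.
(* The constant bounding [Cexp (- w s)] comes from the maximum of its exponent on the compact
   segment. *)
have [c _ cK] : exists2 c, c \in `[(0:R), 1] & forall s, s \in `[(0:R), 1] ->
    - Re (z * s%:C%C) <= - Re (z * c%:C%C).
  apply: EVT_max => //; apply: (@within_continuous_derive _ (fun=> - Re (z * 1))) => s _.
  have [h _] := cderivZ z (cderiv_id s).
  by apply: is_deriveN.
apply: (@ode_approx P (fun M s => P M s * z + r M * s%:C%C ^+ M * 1)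
  (fun s => z * s%:C%C) (fun s => z) (fun=> 1) r
  (expR (- Re (z * c%:C%C)))).
- move=> M; rewrite /P big_ord_recl big1 ?expr0 ?fact0 ?divr1 ?mulr1 ?addr0// => i _.
  by rewrite (_ : 0%:C%C = 0 :> C)// expr0n mulr0.
- by rewrite mulr0.
- by move=> M s _.
- move=> s _; apply: cderiv_eq (cderivZ z (cderiv_id s)) => //.
  by rewrite mulr1.
- by [].
- by move=> s sI; rewrite mul1r Cmod_Cexp ReN ler_expR cK.
- have e : (fun M => Cmod (r M) / M.+1%:R) = (fun M => exp_coeff (Cmod z) M.+1).
    apply/funext => M; rewrite /exp_coeff /= /r CmodM CmodN CmodM CmodX CmodV.
    rewrite Cmod_nat factS natrM exprS invfM.
    ring.
  rewrite e; apply: (cvg_comp (addn 1) (exp_coeff (Cmod z))); last exact: cvg_exp_coeff.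
  exact: cvg_addnl.
Qed.

End ComplexDerivatives.

(** * The binomial series *)

Section BinomialSeries.
Variable R : realType.
Local Notation C := R[i].
Local Notation Re := complex.Re.
Local Notation Im := complex.Im.
Implicit Types (z w u v nu X Y a : C) (x y s S K : R).

(* The binomial coefficient nu (nu - 1) ... (nu - m + 1) / m!. *)
Definition gbin nu (m : nat) : C := (-1) ^+ m * rising (- nu) m / m`!%:R.

Lemma gbin0 nu : gbin nu 0 = 1.
Proof. by rewrite /gbin /rising big_ord0 expr0 fact0 divr1 mulr1. Qed.

Lemma natrC_neq0 m : (m.+1%:R : C) != 0.
Proof. by rewrite pnatr_eq0. Qed.

(** The differential equation of the series, the nonvanishing of its coefficients and their growth
    all rest on this recurrence. *)
Lemma gbinS nu m : m.+1%:R * gbin nu m.+1 = (nu - m%:R) * gbin nu m.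
Proof.
rewrite /gbin /rising big_ord_recr /= factS natrM exprS.
have : (m`!%:R : C) != 0 by rewrite pnatr_eq0 -lt0n fact_gt0.
have := natrC_neq0 m; move: (\prod_(i < m) _) => p.
by rewrite -natr1 => ? ?; field; apply/andP.
Qed.

Lemma gbin_nat n m : gbin n%:R m = 'C(n, m)%:R.
Proof.
elim: m => [|m IH]; first by rewrite gbin0 bin0.
apply: (mulfI (natrC_neq0 m)); rewrite gbinS IH -!natrM mul_bin_left natrM.
have [mn|nm] := leqP m n; first by rewrite natrB.
by rewrite bin_small// !mulr0.
Qed.

Lemma gbin_neq0 nu m : (forall n : nat, nu != n%:R) -> gbin nu m != 0.
Proof.
move=> nuN; elim: m => [|m IH]; first by rewrite gbin0 oner_eq0.
have : m.+1%:R * gbin nu m.+1 != 0 by rewrite gbinS mulf_neq0// subr_eq0.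
by rewrite mulf_eq0 negb_or => /andP[].
Qed.

(** The principal logarithm of [1 + Y] in the half-plane where its real part is positive, written
    with [ln] and [atan] because these can be differentiated without the case distinction of
    [Carg]. *)
Definition log1p_branch Y : C :=
  ((2^-1 * ln ((1 + Re Y) ^+ 2 + Im Y ^+ 2)) +i* atan (Im Y / (1 + Re Y)))%C.

Lemma ReMr s X : Re (s%:C%C * X) = s * Re X.
Proof. by rewrite ReM /= mul0r subr0. Qed.

Lemma ImMr s X : Im (s%:C%C * X) = s * Im X.
Proof. by rewrite ImM /= mul0r addr0. Qed.

Lemma Re_gt0_neq0 z : 0 < Re z -> z != 0.
Proof. by apply: contraTneq => ->; rewrite ltxx. Qed.

Lemma cderiv_log1p X s : 0 < 1 + s * Re X ->
  cderiv (fun x => log1p_branch (x%:C%C * X)) (X / (1 + s%:C%C * X)) s.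
Proof.
move=> pos; set m := (1 + s * Re X) ^+ 2 + (s * Im X) ^+ 2.
have m0 : 0 < m by rewrite ltr_wpDr ?sqr_ge0// exprn_gt0.
have u0 := lt0r_neq0 pos; have m0' := lt0r_neq0 m0.
set a := Re X in pos m m0 u0 m0' *; set b := Im X in m m0 m0' *.
have z0 : 1 + s%:C%C * X != 0 by rewrite Re_gt0_neq0// ReD ReMr.
(* Coordinates obtained by multiplying through by the conjugate of the denominator, whose squared
   modulus is [m]. *)
have eq : X / (1 + s%:C%C * X) =
    (((1 + s * a) * a + s * b ^+ 2) / m +i* (b / m))%C.
  apply: (mulIf z0); rewrite divfK//; apply: complex_eqP.
    by rewrite ReM ReD ImD ReMr ImMr /= -/a -/b /m; field.
  by rewrite ImM ReD ImD ReMr ImMr /= -/a -/b /m; field.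
rewrite eq; pose f x := 1 + x * a; pose g x := x * b.
have dg : is_derive s (1 : R) g b.
  rewrite (_ : g = b *: @id R); last by apply/funext => x; exact: mulrC.
  exact: is_derive_eq (is_deriveZ b (is_derive_id s 1)) (mulr1 b).
have df : is_derive s (1 : R) f a.
  rewrite (_ : f = cst 1 + a *: @id R).
    apply: is_derive_eq (is_deriveD (is_derive_cst _ _ _) (is_deriveZ a (is_derive_id s 1))) _.
    by rewrite add0r; exact: mulr1.
  by apply/funext => x; congr (1 + _); exact: mulrC.
split => /=.
  rewrite (_ : (fun x => _) = 2^-1 *: (@ln R \o (f * f + g * g))); last first.
    by apply/funext => x; rewrite ReMr ImMr !expr2.
  have fgE : (f * f + g * g) s = m by rewrite /m !expr2.
  have dl : is_derive ((f * f + g * g) s) (1 : R) (@ln R) m^-1.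
    by rewrite fgE; exact: is_derive1_ln.
  apply: is_derive_eq (is_deriveZ _ (is_derive1_comp dl
    (is_deriveD (is_deriveM df df) (is_deriveM dg dg)))) _.
  rewrite /GRing.scale /= /f /g; field.
  exact: m0'.
rewrite (_ : (fun x => _) = @atan R \o (g * (fun x => (f x)^-1))); last first.
  by apply/funext => x; rewrite ReMr ImMr.
have d2 := @is_deriveV _ f s a 1 u0 df.
apply: is_derive_eq (is_derive1_comp (is_derive1_atan _) (is_deriveM dg d2)) _.
rewrite /GRing.scale /= !fctE /f /g /m; field.
by rewrite -/m m0' u0.
Qed.

Lemma pos_segment x s : 0 < 1 + x -> 0 <= s <= 1 -> 0 < 1 + s * x.
Proof.
move=> x0 /andP[s0 s1]; have [x1|x1] := leP 0 x.
  by rewrite ltr_pwDl// mulr_ge0.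
by apply: lt_le_trans x0 _; rewrite lerD2l -[leLHS]mul1r ler_wnM2r// ltW.
Qed.

Lemma log1p_branch0 : log1p_branch 0 = 0.
Proof.
by rewrite /log1p_branch /= addr0 expr1n expr0n addr0 ln1 mulr0 mul0r atan0.
Qed.

(* Cexp (- log1p_branch (s X)) * (1 + s X) has derivative 0 in s. *)
Lemma Cexp_log1p X : 0 < 1 + Re X -> Cexp (log1p_branch X) = 1 + X.
Proof.
move=> X0.
pose f (s : R) := Cexp (- log1p_branch (s%:C%C * X)) * (1 + s%:C%C * X).
have f1 : Cmod (f 1 - f 0) <= 0 / 1%:R *+ 2.
  apply: (@cderiv_le_power _ f (fun=> 0) 0 0) => s; last by rewrite Cmod0 mul0r.
  move=> sI; have s1 : 0 < 1 + s * Re X by rewrite pos_segment//; move: sI; rewrite in_itv.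
  have d1 := cderivZ (-1) (cderiv_log1p s1).
  have d2 := cderivD (cderiv_cst 1 s) (cderivM (cderiv_id s) (cderiv_cst X s)).
  have d3 := cderivM (cderiv_exp d1) d2.
  apply: cderiv_eq d3 => [x|]; first by rewrite mulN1r.
  have ? : 1 + s%:C%C * X != 0 by rewrite Re_gt0_neq0// ReD ReMr.
  by field.
move: f1; rewrite mul0r mul0rn => f1.
have /eqP : Cmod (f 1 - f 0) == 0 by rewrite eq_le f1 Cmod_ge0.
move/eqP; rewrite Cmod_eq0 subr_eq0 /f !mul1r !mul0r log1p_branch0 oppr0 Cexp0.
rewrite addr0 mul1r CexpN => /eqP h.
apply: (mulfI (invr_neq0 (Cexp_neq0 (log1p_branch X)))).
by rewrite h mulVf ?Cexp_neq0.
Qed.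

(** The left side is a logarithm of [1 + X] whose imaginary part, an arctangent, lies in the
    principal strip. *)
Lemma log1pE X : 0 < 1 + Re X -> log1p_branch X = Clog (1 + X).
Proof.
move=> X0; rewrite -(Cexp_log1p X0) CexpK//=.
have := atan_gtNpi2 (Im X / (1 + Re X)); have := atan_ltpi2 (Im X / (1 + Re X)).
have := @pi_gt0 R; lra.
Qed.

(** By [gbinS], the truncation [P M] of (1 + s X)^nu satisfies (1 + s X) P' = nu X P + r s^M with
    [r] as below. Since |r| / (M + 1) is at most a constant times the term of degree M, it is enough
    that the terms tend to 0. *)
Lemma binomial_series_halfplane nu X : 0 < 1 + Re X ->
  (fun M => Cmod (gbin nu M * X ^+ M)) @ \oo --> (0 : R) ->
  (fun M => \sum_(m < M.+1) gbin nu m * X ^+ m : C^o) @ \oo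
     --> (Cexp (nu * Clog (1 + X)) : C^o).
Proof.
move=> X0 t0.
pose P M (s : R) := \sum_(m < M.+1) (gbin nu m * X ^+ m) * s%:C%C ^+ m.
pose r M := (M%:R - nu) * gbin nu M * X ^+ M.+1.
pose v (s : R) := (1 + s%:C%C * X)^-1.
pose dP M (s : R) := P M s * (nu * (X / (1 + s%:C%C * X))) + r M * s%:C%C ^+ M * v s.
have pos s : s \in `[0, 1] -> 0 < 1 + s * Re X.
  by move=> sI; rewrite pos_segment//; move: sI; rewrite in_itv.
have neq0 s : s \in `[0, 1] -> 1 + s%:C%C * X != 0.
  by move=> sI; rewrite Re_gt0_neq0// ReD ReMr pos.
have Pd M : {in `[0, 1], forall s, cderiv (P M) (dP M s) s}.
  move=> s sI; have ? := neq0 _ sI; elim: M => [|M IH].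
    apply: cderiv_eq (cderiv_cst 1 s) => [x|].
      by rewrite /P big_ord1 !expr0 gbin0 !mulr1.
    by rewrite /dP /P /r /v big_ord1 gbin0 !expr0 expr1; field.
  have h := cderivD IH (cderivZ (gbin nu M.+1 * X ^+ M.+1) (cderivX M s)).
  apply: cderiv_eq h => [x|]; first by rewrite /P [RHS]big_ord_recr.
  rewrite /dP /P [in RHS]big_ord_recr /= /r /v !exprS.
  move: (\sum_(m < M.+1) _) (gbinS nu M) => p e.
  have e' : gbin nu M.+1 = (nu - M%:R) * gbin nu M / (M.+1%:R).
    by rewrite -e mulrC mulKf// natrC_neq0.
  rewrite e'; have := natrC_neq0 M; rewrite -natr1 => ?; field.
  by apply/andP.
have wd : {in `[0, 1], forall s, cderiv (fun s => nu * log1p_branch (s%:C%C * X))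
    (nu * (X / (1 + s%:C%C * X))) s}.
  by move=> s sI; apply/cderivZ/cderiv_log1p/pos.
have -> : (fun M => \sum_(m < M.+1) gbin nu m * X ^+ m : C^o) = (fun M => P M 1 : C^o).
  by apply/funext => M; apply: eq_bigr => m _; rewrite expr1n mulr1.
have -> : Clog (1 + X) = log1p_branch ((1 : R)%:C%C * X) by rewrite mul1r log1pE.
(* [expR (g s)] is the modulus of [v s * Cexp (- w s)], because [v s] is the exponential of minus
   the logarithm. *)
pose g s := Re ((- nu - 1) * log1p_branch (s%:C%C * X)).
have [c _ cK] : exists2 c, c \in `[(0:R), 1] & forall s, s \in `[(0:R), 1] -> g s <= g c.
  apply: EVT_max => //.
  apply: (@within_continuous_derive _ _
    (fun s => Re ((- nu - 1) * (X / (1 + s%:C%C * X))))) => s sI.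
  by have [] := cderivZ (- nu - 1) (cderiv_log1p (pos _ sI)).
apply: (@ode_approx _ P dP (fun s => nu * log1p_branch (s%:C%C * X))
  (fun s => nu * (X / (1 + s%:C%C * X))) v r (expR (g c))).
- move=> M; rewrite /P big_ord_recl big1 ?expr0 ?gbin0 ?mulr1 ?addr0// => i _.
  by rewrite (_ : 0%:C%C = 0 :> C)// expr0n mulr0.
- by rewrite mul0r log1p_branch0 mulr0.
- exact: Pd.
- exact: wd.
- by [].
- move=> s sI; rewrite /v -(@Cexp_log1p (s%:C%C * X)); last by rewrite ReMr pos.
  rewrite -CexpN -CexpD Cmod_Cexp ler_expR (le_trans _ (cK _ sI))//.
  by rewrite le_eqVlt; apply/orP; left; apply/eqP; congr complex.Re; ring.
- have bnd M : Cmod (r M) / M.+1%:R <= (1 + Cmod nu) * Cmod X * Cmod (gbin nu M * X ^+ M).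
    rewrite ler_pdivrMr ?ltr0n// /r exprSr mulrA mulrAC.
    rewrite (_ : (M%:R - nu) * gbin nu M * X * X ^+ M =
      (M%:R - nu) * X * (gbin nu M * X ^+ M)); last by ring.
    rewrite [X in X <= _]CmodM (CmodM (M%:R - nu)).
    move: (Cmod (gbin nu M * X ^+ M)) (Cmod_ge0 (gbin nu M * X ^+ M)) => y y0.
    rewrite -mulrA (_ : (1 + Cmod nu) * Cmod X * y * M.+1%:R =
      (1 + Cmod nu) * M.+1%:R * (Cmod X * y)); last by ring.
    apply: ler_wpM2r; first by rewrite mulr_ge0 ?Cmod_ge0.
    apply: le_trans (Cmod_triangle _ _) _; rewrite CmodN Cmod_nat -natr1.
    have := Cmod_ge0 nu; have : 0 <= M%:R :> R by rewrite ler0n.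
    nra.
  apply: (@squeeze_cvgr _ _ _ _ (fun=> 0)
    (fun M => (1 + Cmod nu) * Cmod X * Cmod (gbin nu M * X ^+ M))).
  + by apply: nearW => M; rewrite bnd divr_ge0 ?Cmod_ge0.
  + exact: cvg_cst.
  + by rewrite -[X in _ --> X](mulr0 ((1 + Cmod nu) * Cmod X)); apply: cvgMr.
Qed.

Lemma bounded_series_cvg (b : R ^nat) K : (forall m, 0 <= b m) ->
  (forall M, \sum_(m < M) b m <= K) -> cvgn (series b).
Proof.
move=> b0 bK; apply: nondecreasing_is_cvgn.
  by apply: nondecreasing_series => n _ _.
by exists K => _ [M _ <-]; rewrite /series /= big_mkord.
Qed.

(** If S exceeded 1, the ratio |nu - m| S / (m + 1) of consecutive terms would eventually be at
    least 1; the terms, none of which vanishes, would then stay away from 0, against the bounded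
    sums. *)
Lemma binomial_radius nu S K : (forall n : nat, nu != n%:R) -> 0 <= S ->
  (forall M, \sum_(m < M) Cmod (gbin nu m) * S ^+ m <= K) -> S <= 1.
Proof.
move=> nuN S0 sK; rewrite leNgt; apply/negP => S1.
pose b m := Cmod (gbin nu m) * S ^+ m.
have b_gt0 m : 0 < b m.
  by rewrite mulr_gt0 ?exprn_gt0 ?Cmod_gt0 ?gbin_neq0// (lt_trans _ S1).
have b_ge0 m : 0 <= b m by exact: ltW.
have b0 : b @ \oo --> (0 : R) by apply/cvg_series_cvg_0/(bounded_series_cvg b_ge0 sK).
(* From here on m (S - 1) is at least 1 + |nu| S, that is, (m - |nu|) S is at least m + 1. *)
pose m0 := Num.bound ((1 + Cmod nu * S) / (S - 1)).
have bS m : (m0 <= m)%N -> b m <= b m.+1.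
  move=> m0m.
  have hm : (1 + Cmod nu * S) / (S - 1) <= m%:R.
    apply: (@le_trans _ _ m0%:R); last by rewrite ler_nat.
    apply: ltW; apply: archi_boundP; rewrite divr_ge0 ?subr_ge0 ?(ltW S1)//.
    by rewrite addr_ge0// mulr_ge0// Cmod_ge0.
  move: hm; rewrite ler_pdivrMr ?subr_gt0// => hm.
  have m1 : 0 < m.+1%:R :> R by rewrite ltr0n.
  rewrite -(ler_pM2l m1).
  have -> : m.+1%:R * b m.+1 = Cmod (nu - m%:R) * S * b m.
    rewrite /b exprS !mulrA -(Cmod_nat R m.+1) -CmodM gbinS CmodM; ring.
  apply: ler_wpM2r => //; rewrite -natr1.
  have : m%:R - Cmod nu <= Cmod (nu - m%:R).
    rewrite lerBlDr CmodB -[X in X <= _](Cmod_nat R).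
    by apply: le_trans (Cmod_triangle _ _); rewrite subrK.
  nra.
have bm m : (m0 <= m)%N -> b m0 <= b m.
  elim: m => [|m IH]; first by rewrite leqn0 => /eqP ->.
  by rewrite leq_eqVlt => /predU1P[<-//|h]; apply: le_trans (IH h) (bS _ h).
have : b m0 <= 0.
  rewrite -(cvg_lim (@Rhausdorff R) b0); apply: limr_ge; first by apply/cvg_ex; exists 0.
  by exists m0.
by rewrite leNgt b_gt0.
Qed.

(* With t m = gbin nu m * (-1) ^ m and partial sums a M, one has
   (M + 1) t (M + 1) = - nu a M; hence if |a M| had a positive limit, the sum of
   the |t M| would diverge like the harmonic series. *)
Lemma binomial_at_minus_one nu K : (forall n : nat, nu != n%:R) ->
  (forall M, \sum_(m < M) Cmod (gbin nu m) <= K) ->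
  (fun M => \sum_(m < M.+1) gbin nu m * (-1) ^+ m : C^o) @ \oo --> (0 : C^o).
Proof.
move=> nuN sK; apply/cvg_Cmod.
pose t m := gbin nu m * (-1) ^+ m.
pose a M := \sum_(m < M.+1) t m.
have ht M : M.+1%:R * t M.+1 = - nu * a M.
  have tS m : m.+1%:R * t m.+1 = (m%:R - nu) * t m.
    rewrite /t exprS.
    rewrite (_ : m.+1%:R * _ = m.+1%:R * gbin nu m.+1 * - (-1) ^+ m); last by ring.
    by rewrite gbinS; ring.
  elim: M => [|M IH]; first by rewrite tS /a big_ord1 sub0r.
  rewrite tS /a big_ord_recr /= -/(a M) mulrDr -IH; ring.
have mt m : Cmod (t m) = Cmod (gbin nu m).
  by rewrite CmodM CmodX CmodN Cmod1 expr1n mulr1.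
pose al M := Cmod (a M).
(* The increments of [al] are bounded by the |t (M + 1)|, so its telescoping series converges
   absolutely. *)
have cal : cvgn al.
  have -> : al = (fun n => al 0%N + series (telescope al) n).
    by apply/funext => n; exact: eq_sum_telescope.
  apply: is_cvgD; first exact: is_cvg_cst.
  apply: normed_cvg; apply: (@bounded_series_cvg _ K) => [m|M]; first exact: normr_ge0.
  apply: le_trans (_ : \sum_(m < M) Cmod (gbin nu m.+1) <= _); last first.
    apply: le_trans (sK M.+1); rewrite big_ord_recl lerDr Cmod_ge0//.
  apply: ler_sum => m _; rewrite /telescope /= -mt.
  have h (x y : C) : `|Cmod x - Cmod y| <= Cmod (x - y).
    rewrite ler_norml lerNl opprB !lerBlDr [in X in X && _]CmodB.
    by apply/andP; split; apply: le_trans (Cmod_triangle _ _); rewrite subrK.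
  apply: le_trans (h _ _) _; rewrite /a big_ord_recr /= addrAC subrr add0r//.
rewrite (_ : (fun n => _) = al); last by apply/funext => n; rewrite subr0.
have [l lal] : exists l, al @ \oo --> (l : R) by move/cvg_ex: cal.
have l0 : 0 <= l.
  rewrite -(cvg_lim (@Rhausdorff R) lal); apply: limr_ge => //.
  by apply: nearW => n; exact: Cmod_ge0.
have [e0|lpos] := eqVneq 0 l; first by rewrite e0.
have lgt : 0 < l by rewrite lt0r eq_sym lpos.
exfalso.
have [N _ hN] : \forall n \near \oo, l / 2 <= al n.
  by apply: (cvgr_ge l lal); rewrite ltr_pdivrMr// mulr2n mulrDr mulr1 ltrDl.
have nu0 : 0 < Cmod nu by rewrite Cmod_gt0; exact: (nuN 0%N).
apply: (@dvg_harmonic R).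
pose c := (Cmod nu * (l / 2))^-1.
have c0 : 0 <= c by rewrite invr_ge0 mulr_ge0 ?Cmod_ge0// divr_ge0.
apply: (@bounded_series_cvg _ (N%:R + c * K)) => [m|M]; first by rewrite /harmonic /= invr_ge0.
(* The first [N] harmonic terms are bounded by 1; for the others [al m] is at least l / 2, and [c]
   turns |t (m + 1)| into a bound for 1 / (m + 1). *)
apply: le_trans (_ : \sum_(m < M) ((m < N)%N%:R + c * Cmod (gbin nu m.+1)) <= _).
  apply: ler_sum => m _; rewrite /harmonic /=.
  case: ltnP => mN.
    rewrite -[leLHS]addr0; apply: lerD; last by rewrite mulr_ge0 ?Cmod_ge0.
    by rewrite invf_le1 ?ltr0n// ler1n.
  rewrite add0r -mt.
  have m1 : 0 < m.+1%:R :> R by rewrite ltr0n.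
  have -> : Cmod (t m.+1) = Cmod nu * al m / m.+1%:R.
    have := congr1 (@Cmod R) (ht m); rewrite CmodM [RHS]CmodM CmodN Cmod_nat => <-.
    by rewrite mulrC mulKf// lt0r_neq0.
  rewrite mulrA ler_pMl ?invr_gt0// /c ler_pdivlMl ?mulr_gt0 ?divr_gt0//.
  by rewrite mulr1; apply: ler_wpM2l; [exact: ltW|exact: hN].
rewrite big_split /=; apply: lerD.
  rewrite -natr_sum ler_nat; apply: leq_trans (geq_minr M N).
  elim: M => [|M IH]; first by rewrite big_ord0.
  rewrite big_ord_recr /=; lia.
rewrite -mulr_sumr; apply: ler_wpM2l => //.
by apply: le_trans (sK M.+1); rewrite big_ord_recl lerDr Cmod_ge0.
Qed.

(* Unless nu is a natural number, the bound forces S <= 1, hence either X = -1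
   or Re X > -1. *)
Lemma binomial_series nu X S K : Cmod X <= S ->
  (forall M, \sum_(m < M) Cmod (gbin nu m) * S ^+ m <= K) ->
  (fun M => \sum_(m < M.+1) gbin nu m * X ^+ m : C^o) @ \oo
     --> (Cpow 1 (1 + X) nu : C^o).
Proof.
move=> XS sK.
have S0 : 0 <= S by exact: le_trans (Cmod_ge0 X) XS.
(* For a natural exponent [S] may be large, but the series is a finite sum and the binomial theorem
   applies. *)
have [[n ->]|nuN'] := pselect (exists n : nat, nu = n%:R).
  have -> : Cpow 1 (1 + X) n%:R = (1 + X) ^+ n.
    rewrite /Cpow; case: eqP => [->|/eqP X0]; first by rewrite expr0n pnatr_eq0.
    by rewrite CexpMn Clog1 add0r divr1 ClogK.
  apply: cvg_near_cst; exists n => // M /= nM.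
  rewrite exprDn (big_ord_widen M.+1 (fun i => (1 ^+ (n - i) * X ^+ i) *+ 'C(n, i)))//.
  rewrite [RHS]big_mkcond; apply: eq_bigr => i _; rewrite gbin_nat ltnS.
  case: leqP => h; first by rewrite expr1n mul1r mulr_natl.
  by rewrite bin_small// mul0r.
have nuN n : nu != n%:R by apply/eqP => h; apply: nuN'; exists n.
have S1 := binomial_radius nuN S0 sK.
have X1 := le_trans XS S1.
have sXK M : \sum_(m < M) Cmod (gbin nu m * X ^+ m) <= K.
  apply: le_trans (sK M); apply: ler_sum => m _; rewrite CmodM CmodX.
  by apply: ler_wpM2l; rewrite ?Cmod_ge0// lerXn2r// nnegrE ?Cmod_ge0.
have t0 : (fun M => Cmod (gbin nu M * X ^+ M)) @ \oo --> (0 : R).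
  by apply/cvg_series_cvg_0/(bounded_series_cvg _ sXK) => m; exact: Cmod_ge0.
(* [Cpow] of base 0 is 0 here, the exponent 0 being excluded along with the other natural
   numbers. *)
have [X0|X0] := eqVneq (1 + X) 0.
  rewrite /Cpow X0 eqxx (negbTE (nuN 0%N)).
  have XE : X = -1 by apply/eqP; rewrite -addr_eq0 addrC X0.
  rewrite XE; apply: (@binomial_at_minus_one _ K) => // M.
  apply: le_trans (sXK M); rewrite XE; apply: ler_sum => m _.
  by rewrite CmodM CmodX CmodN Cmod1 expr1n mulr1.
rewrite /Cpow (negbTE X0) Clog1 add0r divr1.
apply: binomial_series_halfplane => //.
by case: (Re1D_gt0_or_eq0 X1) => [/eqP|]; rewrite ?(negbTE X0)// ReD.
Qed.

End BinomialSeries.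

(** * Unconditional sums *)

Section UnconditionalSums.
Variable R : realType.
Local Notation C := R[i].
Implicit Types I J T : choiceType.

(* Finite subsets of I are represented by duplicate-free sequences. *)
Definition sums_to I (f : I -> C) (s : C) : Prop :=
  (exists K : R, forall H : seq I, uniq H -> \sum_(i <- H) Cmod (f i) <= K) /\
  (forall e : R, 0 < e -> exists B : seq I, forall H : seq I, uniq H ->
     {subset B <= H} -> Cmod (\sum_(i <- H) f i - s) < e).

Lemma big_uniq_subset (V : nmodType) I (G H : seq I) (F : I -> V) :
  uniq G -> uniq H -> {subset G <= H} ->
  \sum_(i <- H) F i = \sum_(i <- G) F i + \sum_(i <- H | i \notin G) F i.
Proof.
move=> uG uH GH; rewrite (bigID (mem G)) /=; congr (_ + _).
rewrite -big_filter; apply: perm_big; apply: uniq_perm => //.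
  exact: filter_uniq.
by move=> i; rewrite mem_filter /=; case: (boolP (i \in G)) => // /GH ->.
Qed.

Lemma ler_sum_uniq_subset I (G H : seq I) (F : I -> R) :
  (forall i, 0 <= F i) -> uniq G -> uniq H -> {subset G <= H} ->
  \sum_(i <- G) F i <= \sum_(i <- H) F i.
Proof.
move=> F0 uG uH GH; rewrite (big_uniq_subset _ uG uH GH) lerDl.
by apply: sumr_ge0.
Qed.

Lemma abs_summable_bounded I (f : I -> C) : abs_summable f ->
  exists K : R, forall H : seq I, uniq H -> \sum_(i <- H) Cmod (f i) <= K.
Proof.
move=> fs; have fE := fs; move: fE; rewrite /abs_summable summableE => fE.
exists (fine (\esum_(x in [set: I]) `|(Cmod (f x))%:E|%E)) => H uH.
rewrite -lee_fin fineK// -sumEFin.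
have -> : (\sum_(i <- H) (Cmod (f i))%:E = \sum_(i \in [set` H]) `|(Cmod (f i))%:E|)%E.
  rewrite fsbig_seq//; apply: eq_fsbigr => i _.
  by rewrite gee0_abs// lee_fin Cmod_ge0.
by apply: ereal_sup_ubound; exists [set` H] => //; split => //; exact: finite_seq.
Qed.

Lemma bounded_abs_summable I (f : I -> C) (K : R) :
  (forall H : seq I, uniq H -> \sum_(i <- H) Cmod (f i) <= K) -> abs_summable f.
Proof.
move=> fK; rewrite /abs_summable /esum.summable.
apply: (@le_lt_trans _ _ K%:E); last exact: ltry.
apply: ge_ereal_sup => _ [A [finA _] <-].
have -> : (\sum_(i \in A) `|(Cmod (f i))%:E| = \sum_(i <- fset_set A) (Cmod (f i))%:E)%E.
  rewrite fsbig_finite//; apply: eq_bigr => i _.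
  by rewrite gee0_abs// lee_fin Cmod_ge0.
by rewrite sumEFin lee_fin; apply: fK; exact: fset_uniq.
Qed.

(* For an absolutely summable family, s only needs to be a cluster point of the
   net of finite partial sums. *)
Lemma sums_to_cluster I (f : I -> C) s : abs_summable f ->
  (forall (e : R) (B : seq I), 0 < e -> exists H : seq I,
     [/\ uniq H, {subset B <= H} & Cmod (\sum_(i <- H) f i - s) < e]) ->
  sums_to f s.
Proof.
move=> /abs_summable_bounded[K fK] cl; split; first by exists K.
move=> e e0.
pose A : set R := [set x | exists2 H : seq I, uniq H & x = \sum_(i <- H) Cmod (f i)].
have supA : has_sup A.
  split; first by exists 0, [::] => //; rewrite big_nil.
  by exists K => _ [H uH ->]; exact: fK.
have e2 : 0 < e / 2 by rewrite divr_gt0.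
(* [B] carries all the absolute mass up to e / 2, hence what lies outside any [G] containing it
   contributes at most e / 2. *)
have [_ [B uB ->] hB] := sup_adherent e2 supA.
have [G [uG BG hG]] := cl _ B e2.
exists G => H uH GH.
have -> : \sum_(i <- H) f i - s =
    \sum_(i <- H | i \notin G) f i + (\sum_(i <- G) f i - s).
  by rewrite (big_uniq_subset _ uG uH GH) [RHS]addrA [in RHS](addrC _ (\sum_(i <- G) _)).
apply: le_lt_trans (Cmod_triangle _ _) _.
rewrite [ltRHS](splitr e); apply: ler_ltD => //.
apply: le_trans (Cmod_sum _ _ _) _.
have h1 : \sum_(i <- H) Cmod (f i) <= sup A.
  by apply: ub_le_sup; [exact: supA.2|exists H].
rewrite (big_uniq_subset _ uG uH GH) in h1.
have := @ler_sum_uniq_subset _ B G (fun i => Cmod (f i)) (fun i => Cmod_ge0 _) uB uG BG.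
lra.
Qed.

Lemma sums_to_abs_summable I (f : I -> C) s : sums_to f s -> abs_summable f.
Proof. by case=> [[K fK] _]; exact: bounded_abs_summable fK. Qed.

Lemma sums_to_Csum I (f : I -> C) s : sums_to f s -> Csum f = s.
Proof.
case=> _ h; apply: (@cvg_lim C^o); [exact: norm_hausdorff|exact: totally_filter|].
have FF := @filter_filter _ _ (@totally_filter I).
apply: (cvg_Cmod FF (partial_sum (f : I -> C^o)) s).2.
apply/cvgrPdist_lt => e e0.
have [B hB] := h _ e0.
exists [fset x in B]%fset => // H /= BH.
rewrite sub0r normrN ger0_norm ?Cmod_ge0// (_ : partial_sum _ H = \sum_(i <- H) f i); last first.
  by rewrite big_seq_fsetE.
apply: hB; first exact: fset_uniq.
by move=> x xB; apply: (fsubsetP BH); rewrite inE.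
Qed.

(** Replaces the net by sequences, for which limits of sums and products are available. As every [H]
    above [B] is allowed, one sequence can serve several families at once. *)
Lemma sums_to_seq I (f : I -> C) s : sums_to f s ->
  exists B : nat -> seq I, forall H : nat -> seq I,
    (forall n, uniq (H n) /\ {subset B n <= H n}) ->
    (fun n => \sum_(i <- H n) f i : C^o) @ \oo --> (s : C^o).
Proof.
case=> _ h.
have /choice[B hB] n := h n.+1%:R^-1 (ltac:(by rewrite invr_gt0)).
exists B => H hH; apply/cvg_Cmod.
apply: (@squeeze_cvgr _ _ _ _ (fun=> 0) (@harmonic R)).
- apply: nearW => n; rewrite Cmod_ge0/= ltW//.
  by apply: hB; case: (hH n).
- exact: cvg_cst.
- exact: cvg_harmonic.
Qed.

Lemma cvg_Cmod_lt (u : nat -> C) (l : C) (e : R) :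
  (u : nat -> C^o) @ \oo --> (l : C^o) -> 0 < e -> exists n, Cmod (u n - l) < e.
Proof.
move=> /cvg_Cmod /cvgrPdist_lt h e0; have [n _ hn] := h _ e0.
exists n; have := hn n (leqnn n).
by rewrite /= sub0r normrN ger0_norm// Cmod_ge0.
Qed.

(** Every finite set of pairs lies in a rectangle, over which the sum factorizes; rectangles give
    both the absolute bound and the cluster value. *)
Lemma sums_to_mul I J (f : I -> C) (g : J -> C) s t :
  sums_to f s -> sums_to g t -> sums_to (fun x : I * J => f x.1 * g x.2) (s * t).
Proof.
move=> fs gt; have [[[K fK] _] [[L gL] _]] := (fs, gt).
have incl (G : seq (I * J)) (H1 : seq I) (H2 : seq J) :
    {subset [seq x.1 | x <- G] <= H1} -> {subset [seq x.2 | x <- G] <= H2} ->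
    {subset G <= [seq (x, y) | x <- H1, y <- H2]}.
  move=> h1 h2 [x y] xG; apply/allpairsP; exists (x, y); split => //=.
    by apply: h1; apply/mapP; exists (x, y).
  by apply: h2; apply/mapP; exists (x, y).
have uni (H1 : seq I) (H2 : seq J) : uniq H1 -> uniq H2 ->
    uniq [seq (x, y) | x <- H1, y <- H2].
  by move=> u1 u2; apply: allpairs_uniq => // -[? ?] [? ?].
apply: sums_to_cluster.
  apply: (@bounded_abs_summable _ _ (K * L)) => G uG.
  pose H1 := undup [seq x.1 | x <- G]; pose H2 := undup [seq x.2 | x <- G].
  apply: (@le_trans _ _ (\sum_(x <- [seq (x, y) | x <- H1, y <- H2]) Cmod (f x.1 * g x.2))).
    apply: ler_sum_uniq_subset => //; first by move=> i; exact: Cmod_ge0.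
      by apply: uni; exact: undup_uniq.
    by apply: incl => x; rewrite mem_undup.
  rewrite big_allpairs /=.
  under eq_bigr => i _ do under eq_bigr => j _ do rewrite CmodM.
  under eq_bigr => i _ do rewrite -mulr_sumr.
  rewrite -mulr_suml; apply: ler_pM; rewrite ?sumr_ge0// => *; rewrite ?Cmod_ge0//.
    by apply: fK; exact: undup_uniq.
  by apply: gL; exact: undup_uniq.
move=> e B e0.
have [B1 h1] := sums_to_seq fs; have [B2 h2] := sums_to_seq gt.
pose H1 n := undup (B1 n ++ [seq x.1 | x <- B]).
pose H2 n := undup (B2 n ++ [seq x.2 | x <- B]).
have c1 : (fun n => \sum_(i <- H1 n) f i : C^o) @ \oo --> (s : C^o).
  apply: h1 => n; split; first exact: undup_uniq.
  by move=> x xB; rewrite mem_undup mem_cat xB.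
have c2 : (fun n => \sum_(i <- H2 n) g i : C^o) @ \oo --> (t : C^o).
  apply: h2 => n; split; first exact: undup_uniq.
  by move=> x xB; rewrite mem_undup mem_cat xB.
have [n hn] := cvg_Cmod_lt (cvgM c1 c2) e0.
exists [seq (x, y) | x <- H1 n, y <- H2 n]; split.
- by apply: uni; exact: undup_uniq.
- by apply: incl => x xB; rewrite mem_undup mem_cat xB orbT.
- rewrite big_allpairs /=; under eq_bigr => i _ do rewrite -mulr_sumr.
  by rewrite -mulr_suml.
Qed.

(** The cube of side [H]. It is enumerated through positions in [H], since functions into the
    possibly infinite [T] do not form a finite type. *)
Definition ffun_box k T (H : seq T) : seq {ffun 'I_k -> T} :=
  [seq [ffun i => tnth (in_tuple H) (g i)] | g : {ffun 'I_k -> 'I_(size H)}].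

Lemma ffun_box_uniq k T (H : seq T) : uniq H -> uniq (ffun_box k H).
Proof.
move=> uH; rewrite map_inj_uniq ?enum_uniq// => g1 g2 /ffunP h.
apply/ffunP => i; have := h i; rewrite !ffunE.
by apply: (elimT (tuple_uniqP (in_tuple H))).
Qed.

Lemma mem_ffun_box k T (H : seq T) (c : {ffun 'I_k -> T}) :
  (forall i, c i \in H) -> c \in ffun_box k H.
Proof.
move=> h; have lt i : (index (c i) H < size H)%N by rewrite index_mem.
apply/mapP; exists [ffun i => Ordinal (lt i)]; first by rewrite mem_enum.
apply/ffunP => i; rewrite !ffunE (tnth_nth (c i)) /= nth_index//.
Qed.

Lemma big_ffun_box (V : comPzRingType) k T (H : seq T) (F : 'I_k -> T -> V) :
  \sum_(c <- ffun_box k H) \prod_(i < k) F i (c i) =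
  \prod_(i < k) \sum_(x <- H) F i x.
Proof.
rewrite big_image /=.
under [RHS]eq_bigr => i _ do rewrite big_tnth.
rewrite bigA_distr_bigA /=; apply: eq_bigr => g _.
by apply: eq_bigr => i _; rewrite ffunE.
Qed.

Lemma cvg_Cprod k (u : 'I_k -> nat -> C) (l : 'I_k -> C) :
  (forall i, (u i : nat -> C^o) @ \oo --> (l i : C^o)) ->
  (fun n => \prod_(i < k) u i n : C^o) @ \oo --> (\prod_(i < k) l i : C^o).
Proof.
elim: k u l => [|k IH] u l h.
  by under eq_fun => n do rewrite big_ord0; rewrite big_ord0; exact: cvg_cst.
under eq_fun => n do rewrite big_ord_recl; rewrite big_ord_recl.
by apply: cvgM; [exact: h|apply: IH => i; exact: h].
Qed.

Lemma cvg_Csum (I : finType) (P : pred I) (u : I -> nat -> C) (l : I -> C) :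
  (forall i, P i -> (u i : nat -> C^o) @ \oo --> (l i : C^o)) ->
  (fun n => \sum_(i | P i) u i n : C^o) @ \oo --> (\sum_(i | P i) l i : C^o).
Proof.
move=> h; elim: (index_enum I) => [|i r IH].
  by under eq_fun => n do rewrite big_nil; rewrite big_nil; exact: cvg_cst.
under eq_fun => n do rewrite big_cons; rewrite big_cons.
by case: ifP => // Pi; apply: cvgD; first exact: h.
Qed.

(** As for two factors, with cubes instead of rectangles; a single side collects the values of all
    functions in the given finite set. *)
Lemma sums_to_prod k T (f : 'I_k -> T -> C) (s : 'I_k -> C) :
  (forall i, sums_to (f i) (s i)) ->
  sums_to (fun c : {ffun 'I_k -> T} => \prod_(i < k) f i (c i)) (\prod_(i < k) s i).
Proof.
move=> fs; have /choice[K fK] := fun i => (fs i).1.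
pose vals (G : seq {ffun 'I_k -> T}) :=
  flatten [seq [seq (c : {ffun 'I_k -> T}) i | i : 'I_k] | c <- G].
have valsP (G : seq {ffun 'I_k -> T}) c i : c \in G -> c i \in vals G.
  move=> cG; apply/flattenP; exists [seq (c : {ffun 'I_k -> T}) i | i : 'I_k].
    by apply/mapP; exists c.
  by apply/mapP; exists i; rewrite ?mem_enum.
apply: sums_to_cluster.
  apply: (@bounded_abs_summable _ _ (\prod_(i < k) K i)) => G uG.
  pose H := undup (vals G).
  apply: (@le_trans _ _ (\sum_(c <- ffun_box k H) Cmod (\prod_(i < k) f i (c i)))).
    apply: ler_sum_uniq_subset => //; first by move=> c; exact: Cmod_ge0.
      by apply: ffun_box_uniq; exact: undup_uniq.
    by move=> c cG; apply: mem_ffun_box => i; rewrite mem_undup valsP.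
  under eq_bigr => c _ do rewrite Cmod_prod.
  rewrite (@big_ffun_box _ _ _ _ (fun i x => Cmod (f i x))); apply: ler_prod => i _.
  by rewrite sumr_ge0 => [|x _]; rewrite ?Cmod_ge0// fK ?undup_uniq.
move=> e B e0.
have /choice[A hA] := fun i => sums_to_seq (fs i).
pose H n := undup (flatten [seq A i n | i : 'I_k] ++ vals B).
have c i : (fun n => \sum_(x <- H n) f i x : C^o) @ \oo --> (s i : C^o).
  apply: hA => n; split; first exact: undup_uniq.
  move=> x xA; rewrite mem_undup mem_cat; apply/orP; left.
  by apply/flattenP; exists (A i n) => //; apply/mapP; exists i; rewrite ?mem_enum.
have [n hn] := cvg_Cmod_lt (cvg_Cprod c) e0.
exists (ffun_box k (H n)); split.
- by apply: ffun_box_uniq; exact: undup_uniq.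
- by move=> x xB; apply: mem_ffun_box => i; rewrite mem_undup mem_cat valsP// orbT.
- by rewrite big_ffun_box.
Qed.

Lemma sums_to_lincomb (I : finType) T (P : pred I) (a : I -> C) (f : I -> T -> C)
    (s : I -> C) :
  (forall i, P i -> sums_to (f i) (s i)) ->
  sums_to (fun x => \sum_(i | P i) a i * f i x) (\sum_(i | P i) a i * s i).
Proof.
move=> fs.
(* The guard [P i] sits under the existential so that [choice] applies to all [i], with a dummy
   value outside [P]. *)
have /choice[K fK] : forall i, exists K : R, P i -> forall H : seq T, uniq H ->
    \sum_(x <- H) Cmod (f i x) <= K.
  by move=> i; case: (boolP (P i)) => [/fs[[K hK] _]|]; [exists K|exists 0].
apply: sums_to_cluster.
  apply: (@bounded_abs_summable _ _ (\sum_(i | P i) Cmod (a i) * K i)) => H uH.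
  apply: le_trans (_ : \sum_(x <- H) \sum_(i | P i) Cmod (a i) * Cmod (f i x) <= _).
    apply: ler_sum => x _; apply: le_trans (Cmod_sum _ _ _) _.
    by apply: ler_sum => i _; rewrite CmodM.
  rewrite exchange_big /=; apply: ler_sum => i Pi; rewrite -mulr_sumr.
  by apply: ler_wpM2l; rewrite ?Cmod_ge0// fK.
move=> e B e0.
have /choice[A hA] : forall i, exists A : nat -> seq T, P i -> forall H : nat -> seq T,
    (forall n, uniq (H n) /\ {subset A n <= H n}) ->
    (fun n => \sum_(x <- H n) f i x : C^o) @ \oo --> (s i : C^o).
  move=> i; case: (boolP (P i)) => [/fs/sums_to_seq[A h]|]; first by exists A.
  by exists (fun=> [::]).
pose H n := undup (flatten [seq A i n | i : I] ++ B).
have c i : P i -> (fun n => a i * \sum_(x <- H n) f i x : C^o) @ \oo --> (a i * s i : C^o).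
  move=> Pi; apply: cvgMr; apply: (hA _ Pi) => n; split; first exact: undup_uniq.
  move=> x xA; rewrite mem_undup mem_cat; apply/orP; left.
  by apply/flattenP; exists (A i n) => //; apply/mapP; exists i; rewrite ?mem_enum.
have [n hn] := cvg_Cmod_lt (cvg_Csum c) e0.
exists (H n); split; first exact: undup_uniq.
  by move=> x xB; rewrite mem_undup mem_cat xB orbT.
rewrite exchange_big /=.
by under eq_bigr => i _ do rewrite -mulr_sumr.
Qed.

End UnconditionalSums.

(** * Multinomial expansions *)

Section Multinomial.
Variables (K : numFieldType) (T : finType).
Implicit Types (x : T -> K) (m M : nat).

Lemma natr_fact_neq0 m : (m`!%:R : K) != 0.
Proof. by rewrite pnatr_eq0 -lt0n fact_gt0. Qed.

(* Both sides are the coefficient of degree m of the product over T of the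
   exponentials of x D truncated after degree M. *)
Lemma sum_multinomial x m M : (m <= M)%N ->
  \sum_(c : {ffun T -> 'I_M.+1} | (\sum_D c D == m)%N)
     \prod_D (x D ^+ c D / (c D)`!%:R) = (\sum_D x D) ^+ m / m`!%:R.
Proof.
move=> mM; pose E (y : K) := \poly_(j < M.+1) (y ^+ j / j`!%:R).
(* Up to degree [M] truncated exponentials multiply like exponentials: this is the binomial theorem,
   coefficient by coefficient. *)
have coefE (s : seq T) i : (i <= M)%N ->
    (\prod_(D <- s) E (x D))`_i = (\sum_(D <- s) x D) ^+ i / i`!%:R.
  elim: s i => [|D s IH] i iM.
    rewrite !big_nil coef1 expr0n; case: i {iM} => [|i] /=.
      by rewrite fact0 divr1.
    by rewrite mul0r.
  rewrite !big_cons coefM addrC exprDn mulr_suml; apply: eq_bigr => -[j ji] _ /=.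
  rewrite ltnS in ji; rewrite coef_poly ltnS (leq_trans ji iM) IH; last first.
    by rewrite (leq_trans (leq_subr _ _)).
  have := natr_fact_neq0 i; rewrite -(bin_fact ji) !natrM !mulf_eq0 !negb_or.
  by case/and3P=> ? ? ?; rewrite -mulr_natr; field; apply/and3P.
have -> := esym (coefE (index_enum T) m mM).
rewrite (eq_bigr (fun D => \sum_(j < M.+1) (x D ^+ j / j`!%:R) *: 'X^j)); last first.
  by move=> D _; rewrite /E poly_def.
rewrite bigA_distr_bigA coef_sum big_mkcond; apply: eq_bigr => c _.
have -> : \prod_D ((x D ^+ c D / (c D)`!%:R) *: 'X^(c D) : {poly K}) =
    (\prod_D (x D ^+ c D / (c D)`!%:R)) *: 'X^(\sum_D c D).
  by rewrite -prodrXr -scaler_prod.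
rewrite coefZ coefXn eq_sym.
by case: eqP; rewrite ?mulr1 ?mulr0.
Qed.

(** These simplices exhaust the families, and on them a multinomial sum collapses to a partial sum
    in one variable. Bounded values are used to stay in a finite type. *)
Definition simplex_box M : seq {ffun T -> nat} :=
  [seq [ffun D => val ((c : {ffun T -> 'I_M.+1}) D)] |
     c <- enum [pred c : {ffun T -> 'I_M.+1} | (\sum_D c D <= M)%N]].

Lemma simplex_box_uniq M : uniq (simplex_box M).
Proof.
rewrite map_inj_uniq ?enum_uniq// => c1 c2 /ffunP h.
by apply/ffunP => D; apply: val_inj; have := h D; rewrite !ffunE.
Qed.

Lemma mem_simplex_box M (c : {ffun T -> nat}) :
  (\sum_D c D <= M)%N -> c \in simplex_box M.
Proof.
move=> cM.
have lt D : (c D < M.+1)%N.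
  by rewrite ltnS (leq_trans _ cM)// (bigD1 D)//= leq_addr.
apply/mapP; exists [ffun D => Ordinal (lt D)].
  by rewrite mem_enum inE; under eq_bigr => D _ do rewrite ffunE.
by apply/ffunP => D; rewrite !ffunE.
Qed.

(** Families are grouped by total size, each group being a multinomial sum. The general field [K]
    allows its use both for the terms and for their moduli. *)
Lemma sum_simplex_box (g : nat -> K) x M :
  \sum_(c <- simplex_box M)
     g (\sum_D c D)%N * \prod_D (x D ^+ c D / (c D)`!%:R) =
  \sum_(m < M.+1) g m * ((\sum_D x D) ^+ m / m`!%:R).
Proof.
rewrite big_map big_enum /=.
under [RHS]eq_bigr => m _.
  have mM : (m <= M)%N by rewrite -ltnS.
  rewrite -(sum_multinomial x mM) mulr_sumr.
over.
rewrite (exchange_big_dep (fun c : {ffun T -> 'I_M.+1} => (\sum_D c D <= M)%N)) /=; last first.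
  by move=> m c _ /eqP ->; rewrite -ltnS.
apply: eq_big => [c|c cM]; first by rewrite inE.
rewrite inE in cM.
rewrite (big_pred1 (Ordinal (cM : (\sum_D c D < M.+1)%N))) /=.
  congr (g _ * _); first by apply: eq_bigr => D _; rewrite ffunE.
  by apply: eq_bigr => D _; rewrite ffunE.
by move=> m; rewrite /= eq_sym.
Qed.

End Multinomial.

(** * Binomial expansions in several variables and complex powers of quotients *)

Section MultivariateBinomial.
Variables (R : realType) (T : finType).
Local Notation C := R[i].
Implicit Types (x : T -> C) (nu : C).

(* The terms of the expansion of (1 + \sum_D x D) ^ nu. *)
Definition multibin nu x (c : {ffun T -> nat}) : C :=
  gbin nu (\sum_D c D) * (\sum_D c D)%N`!%:R * \prod_D (x D ^+ c D / (c D)`!%:R).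

Lemma sum_simplex_multibin nu x M :
  \sum_(c <- simplex_box T M) multibin nu x c =
  \sum_(m < M.+1) gbin nu m * (\sum_D x D) ^+ m.
Proof.
rewrite /multibin (sum_simplex_box (fun m => gbin nu m * m`!%:R)).
apply: eq_bigr => m _; have := @natr_fact_neq0 C m => ?; field.
exact: natr_fact_neq0.
Qed.

(** The modulus of a term has the same multinomial form in the |x D|, so summing over simplices
    gives a one-variable bound at the sum of the moduli. *)
Lemma multibin_bounded nu x : abs_summable (multibin nu x) ->
  exists K : R, forall M, \sum_(m < M) Cmod (gbin nu m) * (\sum_D Cmod (x D)) ^+ m <= K.
Proof.
move=> /abs_summable_bounded[K hK]; exists K => M.
apply: le_trans (hK _ (simplex_box_uniq T M)).
rewrite [leRHS](eq_bigr (fun c : {ffun T -> nat} =>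
   (fun m => Cmod (gbin nu m) * m`!%:R) (\sum_D c D)%N *
   \prod_D (Cmod (x D) ^+ c D / (c D)`!%:R))); last first.
  move=> c _; rewrite /multibin !CmodM Cmod_prod Cmod_nat; congr (_ * _).
  by apply: eq_bigr => D _; rewrite CmodM CmodX CmodV Cmod_nat.
(* The simplex reaches degree [M], one more than the left side; the extra term is nonnegative. *)
rewrite (sum_simplex_box (fun m => Cmod (gbin nu m) * m`!%:R)) big_ord_recr /=.
rewrite -[leLHS]addr0; apply: lerD.
  apply: ler_sum => m _; rewrite le_eqVlt; apply/orP; left; apply/eqP.
  by field; exact: natr_fact_neq0.
by rewrite !mulr_ge0 ?Cmod_ge0// ?divr_ge0// exprn_ge0// sumr_ge0// => *; exact: Cmod_ge0.
Qed.

Lemma multibin_sums_to nu x : abs_summable (multibin nu x) ->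
  sums_to (multibin nu x) (Cpow 1 (1 + \sum_D x D) nu).
Proof.
move=> fs; have [K hK] := multibin_bounded fs.
have := binomial_series (Cmod_sum _ _ _) hK => /cvg_Cmod /cvgrPdist_lt cv.
apply: sums_to_cluster => // e B e0; have [n _ hn] := cv _ e0.
(* Large enough for the tolerance and, the total of all sizes in [B] bounding each of them, for the
   simplex to contain [B]. *)
pose M := maxn n (\sum_(c <- B) \sum_D c D).
exists (simplex_box T M); split; first exact: simplex_box_uniq.
  move=> c cB; apply: mem_simplex_box; rewrite leq_max; apply/orP; right.
  by rewrite (big_rem c)//= leq_addr.
rewrite sum_simplex_multibin; have := hn M (leq_maxl _ _).
by rewrite /= sub0r normrN ger0_norm// Cmod_ge0.
Qed.

Lemma Cexp_int (m : int) (w : C) : Cexp (m%:~R * w) = Cexp w ^ m.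
Proof.
case: m => n; first exact: CexpMn.
by rewrite NegzE mulrNz mulNr CexpN -pmulrn CexpMn -exprnN.
Qed.

(** With the branch based at [a], only Clog (u / v) has to be split. For integer exponents multiples
    of 2 pi do not matter; otherwise [Clog_div] applies. *)
Lemma Cpow_div (a u v nu : C) : a != 0 -> v != 0 ->
  (exists m : int, nu = m%:~R) \/
    ((u = 0 \/ 0 < complex.Re u) /\ 0 < complex.Re v) ->
  Cpow a (a * (u / v)) nu = Cpow a a nu * (Cpow 1 u nu * Cpow 1 v (- nu)).
Proof.
move=> a0 v0 h; rewrite /Cpow (negbTE a0) (negbTE v0) Clog1 divff// Clog1 addr0.
rewrite mulf_eq0 (negbTE a0) mulf_eq0 invr_eq0 (negbTE v0) orbF /=.
rewrite !add0r !divr1 [a * _]mulrC mulfK//.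
(* If [u = 0], both sides vanish unless [nu = 0], when both are 1. *)
case: eqVneq => [u0|u0].
  case: eqVneq => [->|nu0]; last by rewrite mul0r mulr0.
  by rewrite oppr0 !mul0r Cexp0 !mul1r.
rewrite mulrDr CexpD; congr (_ * _); rewrite mulNr CexpN.
have uv : u / v != 0 by rewrite mulf_neq0 ?invr_eq0.
case: h => [[m ->]|[[/eqP|u1 v1]]]; last 2 first.
- by rewrite (negbTE u0).
- by rewrite Clog_div// mulrBr CexpD CexpN.
by rewrite !Cexp_int !ClogK// expfzMl exprz_inv invr_expz.
Qed.

(* If neither nu nor - nu is a natural number, both sums lie in the closed unit
   disc, so that the two logarithms subtract without change of branch. *)
Lemma multibin_pair (a nu : C) x y :
  a != 0 -> 1 + \sum_D y D != 0 ->
  abs_summable (multibin nu x) -> abs_summable (multibin (- nu) y) ->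
  Cpow a (a * ((1 + \sum_D x D) / (1 + \sum_D y D))) nu =
  Cpow a a nu * (Cpow 1 (1 + \sum_D x D) nu * Cpow 1 (1 + \sum_D y D) (- nu)).
Proof.
move=> a0 y0 /multibin_bounded[K hK] /multibin_bounded[L hL].
apply: Cpow_div => //.
have [[n nuE]|nu1] := pselect (exists n : nat, nu = n%:R).
  by left; exists n%:Z; rewrite nuE.
have [[n nuE]|nu2] := pselect (exists n : nat, - nu = n%:R).
  by left; exists (- n%:Z); rewrite mulrNz -pmulrn -nuE opprK.
have pos (z : T -> C) : 0 <= \sum_D Cmod (z D).
  by apply: sumr_ge0 => D _; exact: Cmod_ge0.
have x1 : Cmod (\sum_D x D) <= 1.
  apply: le_trans (Cmod_sum _ _ _) _; apply: binomial_radius hK => // n.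
  by apply/eqP => h; apply: nu1; exists n.
have y1 : Cmod (\sum_D y D) <= 1.
  apply: le_trans (Cmod_sum _ _ _) _; apply: binomial_radius hL => // n.
  by apply/eqP => h; apply: nu2; exists n.
right; split; first exact: Re1D_gt0_or_eq0.
by case: (Re1D_gt0_or_eq0 y1) => // /eqP; rewrite (negbTE y0).
Qed.

End MultivariateBinomial.

(** * Schur functions and Hurwitz sums *)

Section CharacterSums.
Variable R : realType.
Local Notation C := R[i].
Variable d : nat.
Implicit Types (la : intpart d) (p : nat -> C) (Q t nu : C).

(** The degree is a positive natural number, which the floor in [to_complex] preserves. *)
Lemma chi1_neq0 la : chi1 R la != 0.
Proof.
rewrite /chi1 /to_complex.
have /natrP[m hm] := Cnat_irr1 (irr_label la).
have := irr1_gt0 (irr_label la); rewrite hm ltr0n => m0.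
rewrite -[X in Num.floor X]/((m%:Z)%:~R) intrKfloor.
by rewrite pnatr_eq0 -lt0n.
Qed.

Lemma sym_class_ones : sym_class d (nseq d 1%N) = [set 1%g]%SET.
Proof.
apply/setP => s; rewrite !inE; apply/idP/eqP => [h|->].
  apply/permP => x; rewrite perm1.
  have : #|porbit s x| \in nseq d 1%N.
    by rewrite -(perm_mem h); apply/mapP; exists (porbit s x); rewrite // mem_enum imset_f.
  rewrite mem_nseq => /andP[_ /eqP /eqP /cards1P[y hy]].
  have := porbit_id s x; have := mem_porbit s 1 x.
  by rewrite hy expg1 !inE => /eqP -> /eqP ->.
have p1 x : porbit (1%g : 'S_d) x = [set x]%SET.
  apply/setP => y; rewrite inE; apply/porbitP/eqP => [[n]|->].
    by rewrite expg1n perm1.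
  by exists 0%N; rewrite expg0 perm1.
set L := [seq _ | _ <- _].
have sz : size L = d.
  rewrite size_map -cardE card_imset ?card_ord// => x y.
  by rewrite !p1; exact: set1_inj.
suff -> : L = nseq d 1%N by exact: perm_refl.
rewrite -sz; apply/all_pred1P/allP => n /mapP[X].
by rewrite mem_enum => /imsetP[x _ ->] ->; rewrite p1 cards1.
Qed.

Lemma phi_ones la : phi R la (nseq d 1%N) = 1.
Proof.
rewrite /phi /class_card /chi sym_class_ones cards1 repr_set1 mul1r.
by rewrite divff// chi1_neq0.
Qed.

Lemma val_const1 :
  [seq val x | x <- [tuple (inord 1 : 'I_d.+1) | _ < d]] = nseq d 1%N.
Proof.
set L := map _ _; have sz : size L = d by rewrite size_map size_tuple.
rewrite -sz; apply/all_pred1P/allP => n /mapP[y /tnthP[j ->] ->].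
(* The existence of the index [j] forces d > 0, so that [inord 1] really is 1. *)
by rewrite tnth_mktuple /= inordK// ltnS (leq_ltn_trans _ (ltn_ord j)).
Qed.

Lemma sorted_geq_nseq n : sorted geq (nseq n 1%N).
Proof. by case: n => // n; elim: n => //= n ->. Qed.

Lemma ones_is_intpart : is_intpart [tuple (inord 1 : 'I_d.+1) | _ < d].
Proof. by rewrite /is_intpart val_const1 sorted_geq_nseq sumn_nseq mul1n eqxx. Qed.

Definition ones : intpart d := IntPart ones_is_intpart.

Lemma parts_ones : parts ones = nseq d 1%N.
Proof. by rewrite /parts val_const1; apply/all_filterP; rewrite all_nseq orbT. Qed.

(** If filtering leaves [d] parts, no entry was zero and the parts determine the tuple. *)
Lemma parts_onesP la : (parts la == nseq d 1%N) = (la == ones).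
Proof.
apply/eqP/eqP => [h|->]; last exact: parts_ones.
have : size (parts la) == size [seq val x | x <- intpart_val la].
  by rewrite h size_nseq size_map size_tuple.
rewrite size_filter -all_count => /all_filterP e.
move: h; rewrite /parts e -val_const1 => /(inj_map val_inj) h.
by apply: val_inj; apply: val_inj.
Qed.

Lemma sum_intpart (V : nmodType) (F : intpart d -> V) :
  \sum_(D : intpart d) F D = F ones + \sum_(D : nontriv d) F (val D).
Proof.
rewrite (bigD1 ones) //=; congr (_ + _).
rewrite -(big_sub_cond (fun D : intpart d => parts D != nseq d 1%N) predT).
by apply: eq_bigl => D; rewrite andbT unfold_in parts_onesP.
Qed.

Lemma schurE la p :
  schur la p = chi1 R la / (d`!)%:R * \sum_(D : intpart d) phi R la (parts D) * psum_prod p D.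
Proof.
rewrite /schur !mulr_sumr; apply: eq_bigr => D _.
rewrite /phi; have := chi1_neq0 la => ?; have := @natr_fact_neq0 C d => ?.
by field; apply/andP.
Qed.

Definition xvar la Q t (D : nontriv d) : C :=
  weight (val D) Q t * phi R la (parts (val D)).

(** [weight] is the power-sum product normalized to be 1 at (1^d); the scalar depends on the degree
    alone. *)
Lemma psum_weight Q t (D : intpart d) : Q != 1 -> t != 1 ->
  psum_prod (p_Qt Q t) D = ((1 - Q) / (1 - t)) ^+ d * weight D Q t.
Proof.
move=> Q1 t1; rewrite /weight mulrA -exprMn mulrA divfK ?subr_eq0 1?eq_sym//.
by rewrite divff ?subr_eq0 1?eq_sym// expr1n mul1r.
Qed.

Lemma weight_ones Q t : Q != 1 -> t != 1 -> weight ones Q t = 1.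
Proof.
move=> Q1 t1; rewrite /weight.
rewrite parts_ones big_nseq iter_mulr_1 !expr1 -exprMn.
by rewrite mulrA divfK ?divff ?expr1n// subr_eq0 eq_sym.
Qed.

(** The 1 is the contribution of (1^d), where [phi] and [weight] are both 1. *)
Lemma schur_p_Qt la Q t : Q != 1 -> t != 1 ->
  schur la (p_Qt Q t) =
  chi1 R la / (d`!)%:R * (((1 - Q) / (1 - t)) ^+ d * (1 + \sum_D xvar la Q t D)).
Proof.
move=> Q1 t1; rewrite schurE; congr (_ * _).
under eq_bigr => D _ do rewrite psum_weight// mulrCA.
rewrite -mulr_sumr sum_intpart; congr (_ * (_ + _)).
  by rewrite parts_ones phi_ones weight_ones// mulr1.
by apply: eq_bigr => D _; rewrite mulrC.
Qed.

Lemma schur_ratio la Q t : Q != 1 -> t != 1 ->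
  schur la (p_Qt Q t) / schur la (p_Qt 0 t) =
  (1 - Q) ^+ d * ((1 + \sum_D xvar la Q t D) / (1 + \sum_D xvar la 0 t D)).
Proof.
move=> Q1 t1; have z1 : (0 : C) != 1 by rewrite eq_sym oner_eq0.
rewrite !schur_p_Qt// subr0 mul1r invfM mulrACA divff ?mul1r; last first.
  by rewrite mulf_neq0 ?chi1_neq0// invr_eq0 natr_fact_neq0.
rewrite invfM mulrACA exprMn mulfK// expf_eq0 invr_eq0 subr_eq0 eq_sym.
by rewrite (negbTE t1) andbF.
Qed.

Lemma schur_p_0t_neq0 la t : t != 1 -> schur la (p_Qt 0 t) != 0 ->
  1 + \sum_D xvar la 0 t D != 0.
Proof.
move=> t1; rewrite schur_p_Qt//; last by rewrite eq_sym oner_eq0.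
by apply: contra_neq => ->; rewrite !mulr0.
Qed.

Lemma W_termE la nu Q t :
  W_term la nu Q t = multibin nu (xvar la Q t).
Proof.
apply/funext => c; rewrite /W_term /W /multibin /gbin /family_size.
rewrite divfK ?natr_fact_neq0// -[LHS]mulrA; congr (_ * _).
rewrite -big_split; apply: eq_bigr => D _ /=.
by rewrite /xvar [in RHS]exprMn [RHS]mulrAC.
Qed.

(** Each multiplicity is a sum over [i], so the powers of [phi] factorize over [i], and the families
    become independent once [la] is fixed. *)
Lemma hurwitz_L_args (E : int) N k F (cs : families d k) b (Ds : {ffun 'I_F -> intpart d}) :
  hurwitz R d E N (L_args cs b Ds) =
  \sum_(la : intpart d | (plength la <= N)%N)
     ((d`!)%:R * (chi1 R la / (d`!)%:R) ^ E * phi R la (Gamma d) ^+ b *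
      \prod_(j < F) phi R la (parts (Ds j))) *
     \prod_(i < k) ((\prod_(D : nontriv d) phi R la (parts (val D)) ^+ (cs i).1 D) *
                    (\prod_(D : nontriv d) phi R la (parts (val D)) ^+ (cs i).2 D)).
Proof.
rewrite /hurwitz mulr_sumr; apply: eq_bigr => la _.
rewrite /L_args !big_cat big_flatten big_nseq iter_mulr_1 !big_map. rewrite -!enumT !big_enum /=.
rewrite (_ : \prod_(D : nontriv d) _ = \prod_(i < k) (
    (\prod_(D : nontriv d) phi R la (parts (val D)) ^+ (cs i).1 D) *
                    (\prod_(D : nontriv d) phi R la (parts (val D)) ^+ (cs i).2 D))).
  by ring.
under [RHS]eq_bigr => i _ do rewrite -big_split.
rewrite exchange_big; apply: eq_bigr => D _ /=.
rewrite big_nseq iter_mulr_1 -prodrXr; apply: eq_bigr => i _.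
by rewrite exprD.
Qed.

End CharacterSums.

(** Read with [x] = dim(la) and [y] = d!: the power of d! in [degree_factor] converts the weights of
    [hurwitz] into those of [tau], the [F] factors x / y coming from the Schur functions. *)
Lemma degree_scaling (K : fieldType) (x y : K) (E : int) (F : nat) :
  x != 0 -> y != 0 ->
  y ^ (E - F%:Z - 1) * (y * (x / y) ^ E) = x ^ (E - F%:Z) * (x / y) ^+ F.
Proof.
move=> x0 y0; rewrite exprnP !expfzMl !exprz_inv !expfzDr// -!invr_expz.
have ? : x ^ F != 0 by rewrite expfz_neq0.
have ? : y ^ F != 0 by rewrite expfz_neq0.
have ? : y ^ E != 0 by rewrite expfz_neq0.
rewrite expr1z; field; exact/and4P.
Qed.

(** * Summation over the families *)

Section WeightedHurwitzSums.
Variables (R : realType) (E : int) (F N k d : nat).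
Local Notation C := R[i].
Variables (Q t nu : 'I_k -> C).
Hypothesis t_neq1 : forall i, t i != 1.
Hypothesis Q_neq1 : forall i, Q i != 1.
Hypothesis W_summable : forall i (la : intpart d), (plength la <= N)%N ->
  abs_summable (W_term la (nu i) (Q i) (t i)).
Hypothesis Wbar_summable : forall i (la : intpart d), (plength la <= N)%N ->
  abs_summable (W_term la (- nu i) 0 (t i)).

Definition pair_value (la : intpart d) (i : 'I_k) : C :=
  Cpow 1 (1 + \sum_D xvar la (Q i) (t i) D) (nu i) *
  Cpow 1 (1 + \sum_D xvar la 0 (t i) D) (- nu i).

(** What is left of a summand of the Hurwitz sum once the factors depending on the families are
    removed. *)
Definition L_coef (la : intpart d) (b : nat) (Ds : {ffun 'I_F -> intpart d}) : C :=
  (d`!)%:R * (chi1 R la / (d`!)%:R) ^ E * phi R la (Gamma d) ^+ b *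
  \prod_(j < F) phi R la (parts (Ds j)).

(** For fixed [la] the sum is a product of 2k independent multinomial expansions, each absolutely
    summable by hypothesis; the finitely many [la] are then combined linearly. *)
Lemma L_term_sums_to b (Ds : {ffun 'I_F -> intpart d}) :
  sums_to (L_term E N nu Q t b Ds)
    (\sum_(la : intpart d | (plength la <= N)%N)
       L_coef la b Ds * \prod_(i < k) pair_value la i).
Proof.
pose f (la : intpart d) (cs : families d k) := \prod_(i < k)
  (W_term la (nu i) (Q i) (t i) (cs i).1 * W_term la (- nu i) 0 (t i) (cs i).2).
have -> : L_term E N nu Q t b Ds =
    fun cs => \sum_(la : intpart d | (plength la <= N)%N) L_coef la b Ds * f la cs.
  apply/funext => cs; rewrite /L_term hurwitz_L_args mulr_suml.
  apply: eq_bigr => la _; rewrite -[LHS]mulrA; congr (_ * _).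
  rewrite -big_split; apply: eq_bigr => i _ /=.
  by rewrite /W_term; ring.
apply: sums_to_lincomb => la laN.
apply: (@sums_to_prod _ _ _ (fun i c => W_term la (nu i) (Q i) (t i) c.1 *
  W_term la (- nu i) 0 (t i) c.2)) => i.
have h1 := W_summable i laN; have h2 := Wbar_summable i laN.
apply: sums_to_mul; rewrite W_termE; apply: multibin_sums_to; rewrite -W_termE//.
Qed.

Lemma L_value b (Ds : {ffun 'I_F -> intpart d}) :
  L E N nu Q t b Ds = \sum_(la : intpart d | (plength la <= N)%N)
       L_coef la b Ds * \prod_(i < k) pair_value la i.
Proof. exact/sums_to_Csum/L_term_sums_to. Qed.

(** The factor (1 - Q)^d of the quotient is the base point of the branch, so it splits off
    exactly. *)
Lemma Cpow_schur_ratio (la : intpart d) i : (plength la <= N)%N ->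
  schur la (p_Qt 0 (t i)) != 0 ->
  Cpow ((1 - Q i) ^+ d)
    (schur la (p_Qt (Q i) (t i)) / schur la (p_Qt 0 (t i))) (nu i) =
  Cpow ((1 - Q i) ^+ d) ((1 - Q i) ^+ d) (nu i) * pair_value la i.
Proof.
move=> laN s0; rewrite schur_ratio//; apply: multibin_pair.
- by rewrite expf_neq0// subr_eq0 eq_sym.
- exact: schur_p_0t_neq0 s0.
- by rewrite -W_termE; exact: W_summable.
- by rewrite -W_termE; exact: Wbar_summable.
Qed.

Lemma prod_schur (la : intpart d) (p : 'I_F -> nat -> C) :
  \prod_(j < F) schur la (p j) = (chi1 R la / (d`!)%:R) ^+ F *
   \sum_(Ds : {ffun 'I_F -> intpart d}) (\prod_(j < F) phi R la (parts (Ds j))) *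
       \prod_(j < F) psum_prod (p j) (Ds j).
Proof.
under eq_bigr => j _ do rewrite schurE.
rewrite big_split /= prodr_const card_ord; congr (_ * _).
by rewrite bigA_distr_bigA; apply: eq_bigr => Ds _; rewrite big_split.
Qed.

End WeightedHurwitzSums.

Theorem proposition1 (R : realType) (E : int) (F N k : nat) (n : int)
  (p : 'I_F -> nat -> R[i]) (q t nu : 'I_k -> R[i]) (beta : R[i]) (d : nat)
  (t_neq0 : forall i, t i != 0)
  (t_root : forall i m, (0 < m)%N -> t i ^+ m != 1)
  (Q_neq1 : forall i, q i * t i ^ n != 1)
  (schur_neq0 : forall i (la : intpart d), (plength la <= N)%N ->
     schur la (p_Qt 0 (t i)) != 0)
  (W_summable : forall i (la : intpart d), (plength la <= N)%N ->
     abs_summable (W_term la (nu i) (q i * t i ^ n) (t i)))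
  (Wbar_summable : forall i (la : intpart d), (plength la <= N)%N ->
     abs_summable (W_term la (- nu i) 0 (t i))) :
  (forall b (Ds : {ffun 'I_F -> intpart d}),
     abs_summable (L_term E N nu (fun i => q i * t i ^ n) t b Ds)) /\
  series (fun b : nat =>
      degree_factor d F E n q t nu beta *
      (beta ^+ b / b`!%:R *
       \sum_(Ds : {ffun 'I_F -> intpart d})
          L E N nu (fun i => q i * t i ^ n) t b Ds *
          \prod_(j < F) psum_prod (p j) (Ds j)) : R[i]^o) @ \oo
    --> (tau d E N n p q t nu beta : R[i]^o).
Proof.
have t_neq1 i : t i != 1 by rewrite -[t i]expr1 t_root.
split=> [b Ds|].
  apply: sums_to_abs_summable; exact: L_term_sums_to.
set Q := fun i => q i * t i ^ n.
pose g (la : intpart d) := phi R la (Gamma d).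
pose P (la : intpart d) := \sum_(Ds : {ffun 'I_F -> intpart d})
  (\prod_(j < F) phi R la (parts (Ds j))) * \prod_(j < F) psum_prod (p j) (Ds j).
(* [c la] gathers everything independent of [b], leaving an exponential series in [beta * g la]. *)
pose c (la : intpart d) := degree_factor d F E n q t nu beta *
  ((d`!)%:R * (chi1 R la / (d`!)%:R) ^ E) *
  (\prod_(i < k) pair_value Q t nu la i) * P la.
have tauE : tau d E N n p q t nu beta =
    \sum_(la : intpart d | (plength la <= N)%N) c la * Cexp (beta * g la).
  apply: eq_bigr => la laN; rewrite /r_factor prod_schur -/(P la).
  rewrite (eq_bigr _ (fun i _ => Cpow_schur_ratio t_neq1 Q_neq1 W_summable
    Wbar_summable laN (schur_neq0 i la laN))) big_split /=.
  rewrite /content_f mulrDr CexpD /c /degree_factor.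
  have := degree_scaling E F (chi1_neq0 R la) (natr_fact_neq0 _ d).
  rewrite -/(g la); move: (P la) (\prod_(i < k) Cpow _ _ _) (\prod_(i < k) pair_value _ _ _ _ _).
  move=> x y z e.
  rewrite [LHS](_ : _ = Cexp (beta * (n%:~R * d%:R)) * Cexp (beta * g la) * y * z * x *
    (chi1 R la ^ (E - F%:Z) * (chi1 R la / (d`!)%:R) ^+ F)); last by ring.
  by rewrite -e; ring.
have LE b Ds := @L_value R E F N k d Q t nu W_summable Wbar_summable b Ds.
(* [series] stops before its index while [Cexp_series] includes it; the shift aligns the two. *)
rewrite tauE -cvg_shiftS.
have -> : [sequence series (fun b : nat => degree_factor d F E n q t nu beta *
      (beta ^+ b / b`!%:R *
       \sum_(Ds : {ffun 'I_F -> intpart d})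
          L E N nu Q t b Ds * \prod_(j < F) psum_prod (p j) (Ds j)) : R[i]^o) M.+1]_M =
    (fun M => \sum_(la : intpart d | (plength la <= N)%N)
       c la * \sum_(b < M.+1) ((beta * g la) ^+ b / b`!%:R) : R[i]^o).
  apply/funext => M; rewrite /series /= big_mkord.
  under [RHS]eq_bigr => la _ do rewrite mulr_sumr.
  rewrite exchange_big /=; apply: eq_bigr => b _.
  under eq_bigr => Ds _ do rewrite LE mulr_suml.
  rewrite exchange_big /= !mulr_sumr; apply: eq_bigr => la _.
  rewrite /c /P !mulr_sumr mulr_suml; apply: eq_bigr => Ds _.
  by rewrite /L_coef -/(g la) (exprMn b beta (g la)); ring.
apply: cvg_Csum => la _; apply: cvgMr; exact: Cexp_series.
Qed.
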